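(* Let $\{X^u\}_{u\in\mathbb{N}^2}$ be a one-critical $2$-parameter filtration of a cell complex $X$. For all $q\in\mathbb{N}$, the Betti tables of degree $q$ satisfy $$\operatorname{supp}\xi_0^q\cup\operatorname{supp}\xi_1^q\cup\operatorname{supp}\xi_2^q\subseteq\overline{\mathcal{C}_q(X)}\cup\overline{\mathcal{C}_{q+1}(X)}.$$ Furthermore, the union of the supports of all Betti tables satisfies $$\bigcup_{q\in\mathbb{N}}\mathcal{C}_q(X)\subseteq\bigcup_{q\in\mathbb{N},\,i\in\{0,1,2\}}\operatorname{supp}\xi_i^q\subseteq\bigcup_{q\in\mathbb{N}}\overline{\mathcal{C}_q(X)}.$$
   Context: $\mathbb{F}$ is a fixed field, $\mathbb{N}=\{0,1,\dots\}$, $e_1,e_2$ is the standard basis of $\mathbb{N}^2$, and $\preceq$ is the coordinatewise order on $\mathbb{N}^2$, with least upper bound $\bigvee$. A cell complex is a finite graded set $X=\bigsqcup_{q\in\mathbb{N}}X_q$ (elements of $X_q$ are $q$-cells) with an incidence function $\kappa:X\times X\to\mathbb{F}$ such that $\kappa(\tau,\sigma)\neq0$ implies $\dim\tau=\dim\sigma+1$, and $\sum_{\rho\in X}\kappa(\tau,\rho)\kappa(\rho,\sigma)=0$ for all $\tau,\sigma$. The face partial order $\le$ on $X$ is generated by $\sigma<\tau$ whenever $\kappa(\tau,\sigma)\ne0$. $C_*(X)$ is the chain complex with $C_q(X)$ the $\mathbb{F}$-vector space with basis $X_q$ and $\partial_q(\tau)=\sum_{\sigma\in X_{q-1}}\kappa(\tau,\sigma)\sigma$.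 A subcomplex $A$ is a subset closed under passing to faces, with the restricted incidence function. $H_q(X)$ is the homology of $C_*(X)$ and $H_q(X,A)$ that of $C_*(X)/C_*(A)$. A $2$-parameter filtration of $X$ is a family of subcomplexes $\{X^u\}_{u\in\mathbb{N}^2}$ with $X^u\subseteq X^v$ for $u\preceq v$; one sets $X^w=\emptyset$ if $w\notin\mathbb{N}^2$. It is one-critical if $X^u=\{\sigma\in X\mid h(\sigma)\preceq u\}$ for some order-preserving $h:(X,\le)\to(\mathbb{N}^2,\preceq)$. $S=\mathbb{F}[x_1,x_2]$; $V_q=\bigoplus_{u\in\mathbb{N}^2}H_q(X^u)$ is the $2$-graded $S$-module on which $x_i$ acts by the maps $H_q(X^u)\to H_q(X^{u+e_i})$ induced by inclusion. Its Betti tables are $\xi_i^q(u)=\dim_{\mathbb{F}}(\operatorname{Tor}_i^S(V_q,\mathbb{F}))^u$, where $\mathbb{F}=S/\langle x_1,x_2\rangle$; $\operatorname{supp}\xi_i^q=\{u\mid\xi_i^q(u)\neq0\}$. The set of $q$-homological critical grades is $\mathcal{C}_q(X)=\{u\in\mathbb{N}^2\mid H_q(X^u,X^{u-e_1}\cup X^{u-e_2})\ne0\}$. For $G\subseteq\mathbb{N}^2$, $\overline{G}=\{\bigvee L\mid L\subseteq G\text{ finite}, L\ne\emptyset\}$. *)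

(* Defs.v *)
From HB Require Import structures.
From mathcomp Require Import all_boot all_order all_algebra.
From mathcomp Require classical_sets.

Set Implicit Arguments.
Unset Strict Implicit.
Unset Printing Implicit Defensive.
Import Order.TTheory GRing.Theory.
Local Open Scope ring_scope.

(* [nat *p nat] is nat * nat with the coordinatewise order. *)
Definition grade := (nat *p nat)%type.

Lemma grade_le1 a b : (((a, b) : grade) <= (a.+1, b) :> grade)%O.
Proof. by apply/andP; split; [exact: leqnSn | exact: leqnn]. Qed.

Lemma grade_le2 a b : (((a, b) : grade) <= (a, b.+1) :> grade)%O.
Proof. by apply/andP; split; [exact: leqnn | exact: leqnSn]. Qed.

Definition lub_closure (G : classical_sets.set grade) : classical_sets.set grade :=
  fun u => exists L : seq grade,
    [/\ L != [::], forall v, v \in L -> G v & u = (\join_(v <- L) v)%O].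

Section LinearAlgebra.
Variable K : fieldType.
Implicit Types V : vectType K.

(* The quotient V / W, carried by the complement W^C of W; [qpi W] is the     *)
(* canonical surjection, whose kernel is W, and [qrepr W] a section of it.    *)
Definition quotv V (W : {vspace V}) : vectType K := subvs_of W^C%VS.

Definition qpi V (W : {vspace V}) : 'Hom(V, quotv W) :=
  (linfun (vsproj W^C) \o daddv_pi W^C W)%VF.

Definition qrepr V (W : {vspace V}) : 'Hom(quotv W, V) := linfun vsval.

Lemma qreprK V (W : {vspace V}) x : qpi W (qrepr W x) = x.
Proof.
rewrite comp_lfunE !lfunE /= daddv_pi_id ?subvsP ?vsvalK //.
by rewrite capvC capv_compl.
Qed.

Lemma qpi_eq0 V (W : {vspace V}) x : (qpi W x == 0) = (x \in W).
Proof.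
have dWC : (W^C :&: W = 0)%VS by rewrite capvC capv_compl.
have dW : (W :&: W^C = 0)%VS by rewrite capv_compl.
have xE : daddv_pi W^C W x + daddv_pi W W^C x = x.
  by apply: daddv_pi_add => //; rewrite addvC addv_complf memvf.
apply/idP/idP => [|xW].
  rewrite comp_lfunE lfunE /= => /eqP/(congr1 vsval) /=.
  rewrite vsprojK ?memv_pi // => p0.
  by rewrite -xE p0 add0r memv_pi.
rewrite comp_lfunE lfunE /=.
have -> : daddv_pi W^C W x = 0; last by rewrite linear0.
by apply: (addIr x); rewrite add0r -{2}(daddv_pi_id dW xW).
Qed.

Lemma lker_qpi V (W : {vspace V}) : lker (qpi W) = W.
Proof. by apply/vspaceP => x; rewrite memv_ker qpi_eq0. Qed.

(* The map V1 / W1 -> V2 / W2 induced by f, when f maps W1 into W2. *)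
Definition qmap V1 V2 (W1 : {vspace V1}) (W2 : {vspace V2}) (f : 'Hom(V1, V2)) :
    'Hom(quotv W1, quotv W2) :=
  (qpi W2 \o f \o qrepr W1)%VF.

Lemma qmap_repr V1 V2 (W1 : {vspace V1}) (W2 : {vspace V2})
    (f : 'Hom(V1, V2)) x :
  qmap W1 W2 f x = qpi W2 (f (qrepr W1 x)).
Proof. by rewrite /qmap 2!comp_lfunE. Qed.

Lemma qmapE V1 V2 (W1 : {vspace V1}) (W2 : {vspace V2}) (f : 'Hom(V1, V2)) x :
  (f @: W1 <= W2)%VS -> qmap W1 W2 f (qpi W1 x) = qpi W2 (f x).
Proof.
move=> sf; have xW : qrepr W1 (qpi W1 x) - x \in W1.
  by rewrite -qpi_eq0 linearB /= qreprK subrr.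
apply/eqP; rewrite qmap_repr -subr_eq0.
have <- : qpi W2 (f (qrepr W1 (qpi W1 x) - x)) =
    qpi W2 (f (qrepr W1 (qpi W1 x))) - qpi W2 (f x) by rewrite !linearB.
by rewrite qpi_eq0 (subvP sf) ?memv_img.
Qed.

Lemma qmap_id V (W : {vspace V}) : qmap W W \1%VF = \1%VF.
Proof. by apply/lfunP => x; rewrite qmap_repr !id_lfunE qreprK. Qed.

Lemma qmap_comp V1 V2 V3 (W1 : {vspace V1}) (W2 : {vspace V2})
    (W3 : {vspace V3}) (f : 'Hom(V1, V2)) (g : 'Hom(V2, V3)) :
  (g @: W2 <= W3)%VS ->
  (qmap W2 W3 g \o qmap W1 W2 f)%VF = qmap W1 W3 (g \o f)%VF.
Proof.
move=> sg; apply/lfunP => x.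
by rewrite comp_lfunE [qmap W1 W2 f x]qmap_repr qmapE // qmap_repr comp_lfunE.
Qed.

Lemma lfun_vsval V (U : {vspace V}) (x : subvs_of U) :
  linfun vsval x = vsval x.
Proof. exact: lfunE. Qed.

(* The map U1 -> U2 obtained by restricting f, when f maps U1 into U2. *)
Definition submap V1 V2 (U1 : {vspace V1}) (U2 : {vspace V2})
    (f : 'Hom(V1, V2)) : 'Hom(subvs_of U1, subvs_of U2) :=
  (linfun (vsproj U2) \o f \o linfun vsval)%VF.

Lemma submapE V1 V2 (U1 : {vspace V1}) (U2 : {vspace V2}) (f : 'Hom(V1, V2)) x :
  (f @: U1 <= U2)%VS -> vsval (submap U1 U2 f x) = f (vsval x).
Proof.
move=> sf; rewrite !comp_lfunE !lfunE /= vsprojK //.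
by apply: (subvP sf); rewrite memv_img ?subvsP.
Qed.

Record chain_complex := ChainComplex {
  chain :> nat -> vectType K;
  bd : forall q, 'Hom(chain q.+1, chain q);
  bd_bd : forall q, (bd q \o bd q.+1)%VF = 0 }.
Arguments bd : clear implicits.

Definition cycles (C : chain_complex) q : {vspace C q} :=
  match q with 0 => fullv | q'.+1 => lker (bd C q') end.

(* The boundaries, as a subspace of the space of cycles. *)
Definition boundaries (C : chain_complex) q :
    {vspace (subvs_of (cycles C q))} :=
  (linfun vsval @^-1: limg (bd C q))%VS.

Definition homology (C : chain_complex) q : vectType K :=
  quotv (boundaries C q).

Record chain_map (C D : chain_complex) := ChainMap {
  cmap :> forall q, 'Hom(C q, D q);
  cmap_bd : forall q, (bd D q \o cmap q.+1 = cmap q \o bd C q)%VF }.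

Lemma cmap_cycles C D (f : chain_map C D) q :
  (f q @: cycles C q <= cycles D q)%VS.
Proof.
case: q => [|q] /=; first exact: subvf.
apply/subvP => _ /memv_imgP[x xZ ->]; rewrite memv_ker -comp_lfunE cmap_bd.
by move: xZ; rewrite memv_ker comp_lfunE => /eqP ->; rewrite linear0.
Qed.

Lemma cmap_boundaries C D (f : chain_map C D) q :
  (submap (cycles C q) (cycles D q) (f q) @: boundaries C q
     <= boundaries D q)%VS.
Proof.
apply/subvP => _ /memv_imgP[x + ->]; rewrite /boundaries -!memv_preim.
rewrite !lfun_vsval submapE ?cmap_cycles // => /memv_imgP[y _ ->].
by rewrite -comp_lfunE -cmap_bd comp_lfunE memv_img ?memvf.
Qed.

Definition hmap C D (f : chain_map C D) q : 'Hom(homology C q, homology D q) :=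
  qmap (boundaries C q) (boundaries D q)
    (submap (cycles C q) (cycles D q) (f q)).

Lemma hmap_id C (f : chain_map C C) q : f q = \1%VF -> hmap f q = \1%VF.
Proof.
move=> f1; rewrite /hmap f1 -[RHS]qmap_id; congr qmap.
apply/lfunP => x; apply: val_inj; rewrite /= submapE ?id_lfunE //.
by apply/subvP => _ /memv_imgP[y yU ->]; rewrite id_lfunE.
Qed.

Lemma hmap_comp C D E (f : chain_map C D) (g : chain_map D E)
    (h : chain_map C E) q :
  h q = (g q \o f q)%VF -> hmap h q = (hmap g q \o hmap f q)%VF.
Proof.
move=> hE; rewrite /hmap qmap_comp ?cmap_boundaries //; congr qmap.
apply/lfunP => x; apply: val_inj; rewrite /= submapE ?cmap_cycles //.
by rewrite comp_lfunE !submapE ?cmap_cycles // hE comp_lfunE.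
Qed.

(* The quotient complex D / f(C). *)
Lemma quot_bd C D (f : chain_map C D) q :
  (bd D q @: limg (f q.+1) <= limg (f q))%VS.
Proof.
apply/subvP => _ /memv_imgP[_ /memv_imgP[x _ ->] ->].
by rewrite -comp_lfunE cmap_bd comp_lfunE memv_img ?memvf.
Qed.

Lemma quot_bd_bd C D (f : chain_map C D) q :
  (qmap (limg (f q.+1)) (limg (f q)) (bd D q) \o
     qmap (limg (f q.+2)) (limg (f q.+1)) (bd D q.+1))%VF = 0.
Proof.
rewrite qmap_comp ?quot_bd // bd_bd.
by apply/lfunP => x; rewrite qmap_repr !zero_lfunE linear0.
Qed.

Definition quot_complex C D (f : chain_map C D) : chain_complex :=
  @ChainComplex (fun q => quotv (limg (f q)))
    (fun q => qmap (limg (f q.+1)) (limg (f q)) (bd D q)) (quot_bd_bd f).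

End LinearAlgebra.

Section CellComplexes.
Variable K : fieldType.

Record cell_complex := CellComplex {
  cell :> finType;
  cdim : cell -> nat;
  kappa : cell -> cell -> K;
  kappa_dim : forall t s, kappa t s != 0 -> cdim t = (cdim s).+1;
  kappa_kappa : forall t s, \sum_r kappa t r * kappa r s = 0 }.

Definition face (X : cell_complex) : rel X :=
  connect (fun s t => kappa t s != 0).

Record subcomplex (X : cell_complex) := Subcomplex {
  scells :> {set X};
  scells_face : forall s t : X, face s t -> t \in scells -> s \in scells }.

Variable X : cell_complex.

(* All chains of X live in the space of functions on the cells, where a cell  *)
(* is its indicator function.                                                 *)
Definition cellv (s : X) : {ffun X -> K^o} := [ffun r => (r == s)%:R].

Lemma cellvE s r : cellv s r = (r == s)%:R.
Proof. by rewrite ffunE. Qed.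

Definition boundary : 'End({ffun X -> K^o}) :=
  linfun (fun c : {ffun X -> K^o} => \sum_t c t *: \sum_s kappa t s *: cellv s).

Lemma boundaryE (c : {ffun X -> K^o}) :
  boundary c = \sum_t c t *: \sum_s kappa t s *: cellv s.
Proof.
set f := fun c : {ffun X -> K^o} => \sum_t c t *: \sum_s kappa t s *: cellv s.
have flin : linear f.
  move=> a x y; rewrite /f scaler_sumr -big_split /=; apply: eq_bigr => t _.
  by rewrite !ffunE scalerDl scalerA.
pose fl := GRing.isLinear.Build _ _ _ _ f flin.
pose F : {linear {ffun X -> K^o} -> {ffun X -> K^o}} := HB.pack f fl.
exact: (lfunE F).
Qed.

Lemma boundary_cell t : boundary (cellv t) = \sum_s kappa t s *: cellv s.
Proof.
rewrite boundaryE (bigD1 t) //= cellvE eqxx scale1r.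
rewrite [X in _ + X]big1 ?addr0 // => s st.
by rewrite cellvE (negPf st) scale0r.
Qed.

Lemma boundary_boundary c : boundary (boundary c) = 0.
Proof.
rewrite [boundary c]boundaryE linear_sum big1 // => t _.
rewrite linearZ linear_sum /=.
under eq_bigr => s _ do rewrite linearZ /= boundary_cell scaler_sumr.
rewrite exchange_big big1 ?scaler0 //= => r _.
under eq_bigr => s _ do rewrite scalerA.
by rewrite -scaler_suml kappa_kappa scale0r.
Qed.

(* C_q(A). *)
Definition chains (A : {set X}) q : {vspace {ffun X -> K^o}} :=
  <<[seq cellv s | s <- enum A & cdim s == q]>>%VS.

Lemma cellv_chains (A : {set X}) s : s \in A -> cellv s \in chains A (cdim s).
Proof.
by move=> sA; apply/memv_span/map_f; rewrite mem_filter eqxx mem_enum.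
Qed.

Lemma chains_sub (A B : {set X}) q :
  A \subset B -> (chains A q <= chains B q)%VS.
Proof.
move=> /subsetP sAB; apply: sub_span => _ /mapP[s + ->].
rewrite mem_filter mem_enum => /andP[sq /sAB sB].
by apply: map_f; rewrite mem_filter sq mem_enum.
Qed.

Lemma boundary_chains (A : subcomplex X) q :
  (boundary @: chains A q.+1 <= chains A q)%VS.
Proof.
rewrite limg_span; apply/span_subvP => _ /mapP[_ /mapP[t + ->] ->].
rewrite mem_filter mem_enum boundary_cell => /andP[/eqP tq tA].
apply: memv_suml => s _; have [->|kts] := eqVneq (kappa t s) 0.
  by rewrite scale0r mem0v.
apply: memvZ; move: (kappa_dim kts); rewrite tq => -[->].
by apply: cellv_chains; apply: scells_face tA; apply: connect1.
Qed.

Lemma cellular_bd_bd (A : subcomplex X) q :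
  (submap (chains A q.+1) (chains A q) boundary \o
     submap (chains A q.+2) (chains A q.+1) boundary)%VF = 0.
Proof.
apply/lfunP => x; apply: val_inj; rewrite /= comp_lfunE zero_lfunE.
by rewrite !submapE ?boundary_chains // boundary_boundary.
Qed.

Definition cellular (A : subcomplex X) : chain_complex K :=
  @ChainComplex K (fun q => subvs_of (chains A q))
    (fun q => submap (chains A q.+1) (chains A q) boundary) (cellular_bd_bd A).

Lemma chains_incl (A B : subcomplex X) q : A \subset B ->
  (\1%VF @: chains A q <= chains B q)%VS.
Proof. by move=> sAB; rewrite lim1g chains_sub. Qed.

Lemma incl_bd (A B : subcomplex X) (sAB : A \subset B) q :
  (bd (cellular B) q \o submap (chains A q.+1) (chains B q.+1) \1 =
     submap (chains A q) (chains B q) \1 \o bd (cellular A) q)%VF.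
Proof.
apply/lfunP => x; apply: val_inj.
rewrite /= comp_lfunE [X in _ = vsval X]comp_lfunE.
by rewrite !submapE ?boundary_chains ?chains_incl // !id_lfunE.
Qed.

(* The chain map C_*(A) -> C_*(B) induced by the inclusion of A in B. *)
Definition incl (A B : subcomplex X) (sAB : A \subset B) :
    chain_map (cellular A) (cellular B) :=
  @ChainMap _ (cellular A) (cellular B)
    (fun q => submap (chains A q) (chains B q) \1%VF) (incl_bd sAB).

(* H_q(B, A). *)
Definition rel_homology (A B : subcomplex X) (sAB : A \subset B) q :
  vectType K := homology (quot_complex (incl sAB)) q.

Definition sub0 : subcomplex X.
Proof. by exists set0 => s t _; rewrite !inE. Defined.

Definition subU (A B : subcomplex X) : subcomplex X.
Proof.
exists (A :|: B)%SET => s t st; rewrite !inE => /orP[] /(scells_face st) ->;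
  by rewrite ?orbT.
Defined.

Record bifiltration := Bifiltration {
  stage :> grade -> subcomplex X;
  stage_sub : forall u v, (u <= v)%O -> stage u \subset stage v }.

Definition one_critical (Xf : bifiltration) : Prop :=
  exists h : X -> grade,
    (forall s t, face s t -> (h s <= h t)%O) /\
    (forall u, Xf u = [set s | (h s <= u)%O]%SET :> {set X}).

Variable Xf : bifiltration.

(* X^(u - e_1) and X^(u - e_2), which are empty when u - e_i is not in N^2. *)
Definition stage_pred1 (u : grade) : subcomplex X :=
  if u is (a.+1, b) then Xf (a, b) else sub0.

Definition stage_pred2 (u : grade) : subcomplex X :=
  if u is (a, b.+1) then Xf (a, b) else sub0.

Lemma stage_pred_sub u : subU (stage_pred1 u) (stage_pred2 u) \subset Xf u.
Proof.
rewrite subUset; case: u => a b; apply/andP; split.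
  by case: a => [|a]; [exact: sub0set | exact/stage_sub/grade_le1].
by case: b => [|b]; [exact: sub0set | exact/stage_sub/grade_le2].
Qed.

Definition critical_grades q : classical_sets.set grade :=
  fun u => \dim {: rel_homology (stage_pred_sub u) q} != 0%N.

End CellComplexes.

Section GradedModules.
Variable K : fieldType.

(* A 2-graded K[x_1, x_2]-module with finite-dimensional homogeneous          *)
(* components: [xmul u v] is the multiplication by the monomial x^(v - u)     *)
(* from the component of grade u to that of grade v; it is only meaningful    *)
(* for u <= v. In particular x_i acts by [xmul u (u + e_i)].                  *)
Record gmod := Gmod {
  gpart :> grade -> vectType K;
  xmul : forall u v, 'Hom(gpart u, gpart v);
  xmul_id : forall u, xmul u u = \1%VF;
  xmul_comp : forall u v w, (u <= v)%O -> (v <= w)%O ->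
    (xmul v w \o xmul u v)%VF = xmul u w }.
Arguments xmul : clear implicits.

(* Morphisms of grade 0. *)
Record gmor (M N : gmod) := Gmor {
  gfun :> forall u, 'Hom(M u, N u);
  gfun_xmul : forall u v, (u <= v)%O ->
    (gfun v \o xmul M u v = xmul N u v \o gfun u)%VF }.

Lemma gcomp_xmul (M N P : gmod) (g : gmor N P) (f : gmor M N) u v :
  (u <= v)%O ->
  ((g v \o f v) \o xmul M u v = xmul P u v \o (g u \o f u))%VF.
Proof.
by move=> uv; rewrite -comp_lfunA gfun_xmul // !comp_lfunA gfun_xmul.
Qed.

Definition gcomp (M N P : gmod) (g : gmor N P) (f : gmor M N) : gmor M P :=
  @Gmor M P (fun u => g u \o f u)%VF (gcomp_xmul g f).

Section Kernel.
Variables (M N : gmod) (f : gmor M N).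

Lemma ker_sub u v : (u <= v)%O ->
  (xmul M u v @: lker (f u) <= lker (f v))%VS.
Proof.
move=> uv; apply/subvP => _ /memv_imgP[x xK ->].
rewrite memv_ker -comp_lfunE gfun_xmul // comp_lfunE.
by move: xK; rewrite memv_ker => /eqP ->; rewrite linear0.
Qed.

Lemma ker_xmul_id u : submap (lker (f u)) (lker (f u)) (xmul M u u) = \1%VF.
Proof.
apply/lfunP => x; apply: val_inj.
by rewrite /= submapE ?ker_sub // xmul_id !id_lfunE.
Qed.

Lemma ker_xmul_comp u v w : (u <= v)%O -> (v <= w)%O ->
  (submap (lker (f v)) (lker (f w)) (xmul M v w) \o
     submap (lker (f u)) (lker (f v)) (xmul M u v))%VF =
  submap (lker (f u)) (lker (f w)) (xmul M u w).
Proof.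
move=> uv vw; apply/lfunP => x; apply: val_inj.
rewrite comp_lfunE /= !submapE ?ker_sub ?(le_trans uv) //.
by rewrite -comp_lfunE xmul_comp.
Qed.

Definition gker : gmod :=
  @Gmod (fun u => subvs_of (lker (f u)))
    (fun u v => submap (lker (f u)) (lker (f v)) (xmul M u v))
    ker_xmul_id ker_xmul_comp.

Lemma gker_incl_xmul u v : (u <= v)%O ->
  (linfun vsval \o xmul gker u v = xmul M u v \o linfun vsval)%VF.
Proof.
move=> uv; apply/lfunP => x; rewrite comp_lfunE [RHS]comp_lfunE.
by rewrite !lfun_vsval submapE ?ker_sub.
Qed.

Definition gker_incl : gmor gker M :=
  @Gmor gker M (fun u => linfun vsval) gker_incl_xmul.

End Kernel.

Section Free.
Variable beta : grade -> nat.

(* The generators of grade v <= u of the free module on beta v generators in  *)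
(* each grade v; the component of grade u has the elements x^(u - v) g, for   *)
(* g such a generator, as a basis.                                            *)
Definition gens (u : grade) : finType :=
  {v : 'I_u.1.+1 * 'I_u.2.+1 & 'I_(beta (val v.1, val v.2))}.

Definition gen_grade u (g : gens u) : grade :=
  (val (tag g).1, val (tag g).2).

Definition gen_index u (g : gens u) : nat := tagged g.

Definition same_gen u v (g : gens u) (h : gens v) : bool :=
  (gen_grade g == gen_grade h) && (gen_index g == gen_index h).

Lemma gen_grade_le u (g : gens u) : (gen_grade g <= u)%O.
Proof.
rewrite leEprod; apply/andP; split.
  exact: (leq_ord (tag g).1).
exact: (leq_ord (tag g).2).
Qed.

Lemma same_genE u (g h : gens u) : same_gen g h = (g == h).
Proof.
apply/idP/eqP => [|->]; last by rewrite /same_gen !eqxx.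
case: g h => -[[a ha] [b hb]] [k hk] [[[a' ha'] [b' hb']] [k' hk']].
rewrite /same_gen /gen_grade /gen_index /= => /andP[/eqP[E1 E2] /eqP E3].
move: E1 E2 E3 => /= E1 E2 E3; subst a' b' k'.
rewrite (bool_irrelevance ha' ha) (bool_irrelevance hb' hb) in hk' *.
by rewrite (bool_irrelevance hk' hk).
Qed.

Lemma same_gen_exists u v (g : gens u) : (u <= v)%O ->
  exists h : gens v, same_gen g h.
Proof.
case: g => -[[a ha] [b hb]] [k hk]; rewrite leEprod => /andP[uv1 uv2].
have ha' : (a < v.1.+1)%N := leq_trans ha (uv1 : (u.1 < v.1.+1)%N).
have hb' : (b < v.2.+1)%N := leq_trans hb (uv2 : (u.2 < v.2.+1)%N).
pose w : 'I_v.1.+1 * 'I_v.2.+1 := (Ordinal ha', Ordinal hb').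
exists (Tagged (fun w : 'I_v.1.+1 * 'I_v.2.+1 => 'I_(beta (val w.1, val w.2)))
  (Ordinal hk : 'I_(beta (val w.1, val w.2)))).
by rewrite /same_gen !eqxx.
Qed.

(* x^(v - u) sends the basis element x^(u - w) g to x^(v - w) g. *)
Definition free_xmul u v : 'Hom({ffun gens u -> K^o}, {ffun gens v -> K^o}) :=
  linfun (fun c : {ffun gens u -> K^o} =>
    [ffun h : gens v => \sum_(g | same_gen g h) c g] : {ffun gens v -> K^o}).

Lemma free_xmulE u v (c : {ffun gens u -> K^o}) h :
  free_xmul u v c h = \sum_(g | same_gen g h) c g.
Proof.
set f := fun c : {ffun gens u -> K^o} =>
  [ffun h : gens v => \sum_(g | same_gen g h) c g] : {ffun gens v -> K^o}.
have flin : linear f.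
  move=> a x y; apply/ffunP => k; rewrite !ffunE scaler_sumr -big_split /=.
  by apply: eq_bigr => g _; rewrite !ffunE.
pose fl := GRing.isLinear.Build _ _ _ _ f flin.
pose F : {linear {ffun gens u -> K^o} -> {ffun gens v -> K^o}} := HB.pack f fl.
by rewrite (lfunE F) /= ffunE.
Qed.

Lemma free_xmul_id u : free_xmul u u = \1%VF.
Proof.
apply/lfunP => c; apply/ffunP => h; rewrite free_xmulE id_lfunE.
by rewrite (eq_bigl (fun g => g == h)) ?big_pred1_eq // => g; rewrite same_genE.
Qed.

Lemma free_xmul_comp u v w : (u <= v)%O -> (v <= w)%O ->
  (free_xmul v w \o free_xmul u v)%VF = free_xmul u w.
Proof.
move=> uv vw; apply/lfunP => c; apply/ffunP => h.
rewrite comp_lfunE !free_xmulE.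
under eq_bigr => g _ do rewrite free_xmulE.
rewrite (exchange_big_dep (fun k => same_gen k h)) /=; last first.
  by move=> g k /andP[/eqP a /eqP b] /andP[/eqP c' /eqP d];
    rewrite /same_gen c' a d b !eqxx.
apply: eq_bigr => k /andP[/eqP k1 /eqP k2].
have [g kg] := same_gen_exists k uv.
rewrite (big_pred1 g) // => g' /=; rewrite -same_genE.
move: kg => /andP[/eqP g1 /eqP g2].
rewrite /same_gen -k1 -k2 g1 g2.
by rewrite ![gen_grade g == _]eq_sym ![gen_index g == _]eq_sym andbb.
Qed.

Definition gfree : gmod :=
  @Gmod (fun u => {ffun gens u -> K^o}) free_xmul free_xmul_id free_xmul_comp.

End Free.

Section Cover.
Variable M : gmod.

Definition gdim (u : grade) : nat := \dim {: M u}.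

(* The free module on all the vectors of a homogeneous basis of M, and its    *)
(* canonical surjection onto M.                                               *)
Definition cover_fun u : 'Hom({ffun gens gdim u -> K^o}, M u) :=
  linfun (fun c : {ffun gens gdim u -> K^o} =>
    \sum_g c g *: xmul M (gen_grade g) u
                    (vbasis {: M (gen_grade g)})`_(gen_index g)).

Lemma cover_funE u (c : {ffun gens gdim u -> K^o}) :
  cover_fun u c =
    \sum_g c g *: xmul M (gen_grade g) u
                    (vbasis {: M (gen_grade g)})`_(gen_index g).
Proof.
set f := fun c : {ffun gens gdim u -> K^o} =>
    \sum_g c g *: xmul M (gen_grade g) u
                    (vbasis {: M (gen_grade g)})`_(gen_index g).
have flin : linear f.
  move=> a x y; rewrite /f scaler_sumr -big_split /=; apply: eq_bigr => t _.
  by rewrite !ffunE scalerDl scalerA.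
pose fl := GRing.isLinear.Build _ _ _ _ f flin.
pose F : {linear {ffun gens gdim u -> K^o} -> M u} := HB.pack f fl.
exact: (lfunE F).
Qed.

Lemma cover_xmul u v : (u <= v)%O ->
  (cover_fun v \o xmul (gfree gdim) u v = xmul M u v \o cover_fun u)%VF.
Proof.
move=> uv; apply/lfunP => c; rewrite !comp_lfunE !cover_funE linear_sum /=.
under eq_bigr => g _ do rewrite free_xmulE scaler_suml.
rewrite (exchange_big_dep xpredT) //=; apply: eq_bigr => k _.
have [g kg] := same_gen_exists k uv.
rewrite (big_pred1 g) => [|g' /=]; last first.
  move: kg => /andP[/eqP g1 /eqP g2]; rewrite -same_genE /same_gen g1 g2.
  by rewrite ![gen_grade g == _]eq_sym ![gen_index g == _]eq_sym.
rewrite linearZ /=; congr (_ *: _); move: kg => /andP[/eqP g1 /eqP g2].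
rewrite -g2 -g1 -[RHS]comp_lfunE xmul_comp //; exact: gen_grade_le.
Qed.

Definition cover : gmor (gfree gdim) M :=
  @Gmor (gfree gdim) M cover_fun cover_xmul.

Lemma cover_surj u : limg (cover u) = fullv.
Proof.
apply/eqP; rewrite eqEsubv subvf /= -(span_basis (vbasisP fullv)).
apply/span_subvP => x /(nthP 0)[k]; rewrite size_tuple => hk <-.
pose w : 'I_u.1.+1 * 'I_u.2.+1 := (ord_max, ord_max).
have uE : (val w.1, val w.2) = u := esym (surjective_pairing u).
have hk' : (k < gdim (val w.1, val w.2))%N by rewrite uE.
pose g : gens gdim u :=
  Tagged (fun w : 'I_u.1.+1 * 'I_u.2.+1 => 'I_(gdim (val w.1, val w.2)))
    (Ordinal hk').
apply/memv_imgP; exists [ffun h => (h == g)%:R]; rewrite ?memvf //.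
rewrite cover_funE (bigD1 g) //= big1 => [|h hg]; rewrite !ffunE; last first.
  by rewrite (negPf hg) scale0r.
rewrite eqxx scale1r addr0.
have gE : gen_grade g = u := uE.
have -> : gen_index g = k by [].
by move: (gen_grade g) gE => v ->; rewrite xmul_id id_lfunE.
Qed.

End Cover.

Section Tor.
Variable M : gmod.

(* The standard free resolution of M by covers of the iterated syzygies. *)
Definition syz n : gmod := iter n (fun N => gker (cover N)) M.

Definition res n : gmod := gfree (gdim (syz n)).

Definition res_aug : gmor (res 0) M := cover M.

Definition res_d n : gmor (res n.+1) (res n) :=
  gcomp (gker_incl (cover (syz n))) (cover (syz n.+1)).

Lemma res_aug_surj u : limg (res_aug u) = fullv.
Proof. exact: cover_surj. Qed.

Lemma res_d_img n u : limg (res_d n u) = lker (cover (syz n) u).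
Proof.
rewrite /= limg_comp cover_surj; apply/vspaceP => x; apply/memv_imgP/idP.
  by move=> [y _ ->]; rewrite lfun_vsval subvsP.
by move=> xK; exists (vsproj _ x); rewrite ?memvf // lfun_vsval vsprojK.
Qed.

Lemma res_aug_exact u : limg (res_d 0 u) = lker (res_aug u).
Proof. exact: res_d_img. Qed.

Lemma res_d_exact n u : limg (res_d n.+1 u) = lker (res_d n u).
Proof.
rewrite res_d_img; apply/vspaceP => x; rewrite !memv_ker /=.
rewrite [in RHS]comp_lfunE lfun_vsval.
by apply/eqP/eqP => [->|xK]; [rewrite linear0|apply: val_inj].
Qed.

End Tor.

(* The component of grade u of <x_1, x_2> N, that is                          *)
(* x_1 N^(u - e_1) + x_2 N^(u - e_2).                                         *)
Definition irrelevant (N : gmod) (u : grade) : {vspace (N u)} :=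
  ((if u.1 is a.+1 then limg (xmul N (a, u.2) u) else 0) +
   (if u.2 is b.+1 then limg (xmul N (u.1, b) u) else 0))%VS.

(* The component of grade u of N (x) K, for K = S / <x_1, x_2>, that is of    *)
(* N / <x_1, x_2> N.                                                          *)
Definition tensK (N : gmod) (u : grade) : vectType K := quotv (irrelevant N u).

Definition tensK_map (N P : gmod) (f : gmor N P) (u : grade) :
    'Hom(tensK N u, tensK P u) :=
  qmap (irrelevant N u) (irrelevant P u) (f u).

Lemma irrelevant_map (N P : gmod) (f : gmor N P) u :
  (f u @: irrelevant N u <= irrelevant P u)%VS.
Proof.
rewrite /irrelevant limgD; apply: addvS; case: u => [[|a] [|b]] /=;
  rewrite ?limg0 ?sub0v //; apply/subvP => _ /memv_imgP[_ /memv_imgP[x _ ->] ->];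
  by rewrite -comp_lfunE gfun_xmul ?grade_le1 ?grade_le2 // comp_lfunE
             memv_img ?memvf.
Qed.

Lemma torK_bd_bd (M : gmod) u n :
  (tensK_map (res_d M n) u \o tensK_map (res_d M n.+1) u)%VF = 0.
Proof.
rewrite /tensK_map qmap_comp ?irrelevant_map //.
have -> : (res_d M n u \o res_d M n.+1 u)%VF = 0.
  apply/lfunP => x; rewrite comp_lfunE zero_lfunE; apply/eqP.
  by rewrite -memv_ker -res_d_exact memv_img ?memvf.
by apply/lfunP => x; rewrite qmap_repr !zero_lfunE linear0.
Qed.

Definition torK_complex (M : gmod) (u : grade) : chain_complex K :=
  @ChainComplex K (fun n => tensK (res M n) u)
    (fun n => tensK_map (res_d M n) u) (torK_bd_bd M u).

(* (Tor_i^S(M, K))^u. *)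
Definition torK (M : gmod) (i : nat) (u : grade) : vectType K :=
  homology (torK_complex M u) i.

End GradedModules.

Section PersistentHomology.
Variables (K : fieldType) (X : cell_complex K) (Xf : bifiltration X) (q : nat).

(* For u <= v, the map H_q(X^u) -> H_q(X^v) induced by inclusion. *)
Definition persist_map (u v : grade) :
    'Hom(homology (cellular (Xf u)) q, homology (cellular (Xf v)) q) :=
  match @idP (u <= v)%O with
  | ReflectT uv => hmap (incl (stage_sub Xf uv)) q
  | ReflectF _ => 0
  end.

Lemma persist_mapE u v (uv : (u <= v)%O) :
  persist_map u v = hmap (incl (stage_sub Xf uv)) q.
Proof.
by rewrite /persist_map; case: {-}_ / idP.
Qed.

Lemma persist_id u : persist_map u u = \1%VF.
Proof.
rewrite (persist_mapE (lexx u)); apply: hmap_id => /=.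
apply/lfunP => x; apply: val_inj.
by rewrite /= submapE ?chains_incl // !id_lfunE.
Qed.

Lemma persist_comp u v w : (u <= v)%O -> (v <= w)%O ->
  (persist_map v w \o persist_map u v)%VF = persist_map u w.
Proof.
move=> uv vw; have uw := le_trans uv vw.
rewrite (persist_mapE uv) (persist_mapE vw) (persist_mapE uw).
apply/esym/hmap_comp/lfunP => x; apply: val_inj.
by rewrite comp_lfunE /= !submapE ?chains_incl ?stage_sub // !id_lfunE.
Qed.

(* V_q. *)
Definition persistence_module : gmod K :=
  @Gmod K (fun u => homology (cellular (Xf u)) q) persist_map
    persist_id persist_comp.

(* xi_i^q. *)
Definition betti (i : nat) (u : grade) : nat :=
  \dim {: torK persistence_module i u}.

Definition supp_betti (i : nat) : classical_sets.set grade := fun u => betti i u != 0%N.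

End PersistentHomology.

(* Main.v *)
Require Import Defs.
From mathcomp Require Import all_boot all_order all_algebra.
From mathcomp Require Import ring.

(* Tor_i(V, F) in grade u vanishes iff the Koszul complex                     *)
(*     V(u - e1 - e2) -> V(u - e1) (+) V(u - e2) -> V(u)                      *)
(* is exact at the corresponding place, by dimension shifting along the       *)
(* standard resolution.  For V = V_q and a one-critical filtration, where     *)
(* X^(u - e1) and X^(u - e2) meet in X^(u - e1 - e2), this becomes a          *)
(* condition on chains.  If the three conditions hold at u in the degrees q,  *)
(* q - 1 and q - 2, then a diagram chase shows that u is not in C_q;          *)
(* conversely, u not in C_(q+1) gives exactness in the middle for V_q.        *)
(* If u is not in the closure of C_q, then C_q misses all grades below u in   *)
(* the column of u, or all those in its row: otherwise u would be the join of *)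
(* a critical grade in its column and one in its row.  In the first case,     *)
(* adding the grades of the column one at a time does not change the relative *)
(* homology in degree q; this gives xi_0^q(u) = 0 and, with q + 1 in place of *)
(* q, xi_2^q(u) = 0.                                                          *)

Set Implicit Arguments.
Unset Strict Implicit.
Unset Printing Implicit Defensive.
Import Order.TTheory GRing.Theory.
Local Open Scope ring_scope.

(** [tor0_koszul], [tor1_koszul] and [tor2_koszul] identify the Betti tables with Koszul homology.
    They rest on [koszul1_shift] and [koszul2_shift], the connecting maps for a syzygy inside its
    free cover, and on [free_koszul1] and [free_koszul2]. [koszul0_persistence] and its companions
    pass to cycles and boundaries.

    The chains of $X^{u-e_1-e_2}$, of $X^{u-e_1}$ and $X^{u-e_2}$, and of $X^u$ form a double
    complex that computes $H_*(X^u, X^{u-e_1}\cup X^{u-e_2})$. Its spectral sequence starts from the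
    Koszul homology of the modules $V_p$, whence [noncritical_koszul]. In the other direction
    [koszul1_noncritical] gives $\operatorname{supp}\xi_1^q\subseteq\mathcal{C}_{q+1}(X)$, without
    closure. For $\xi_0^q$ and $\xi_2^q$, [lub_closure_cases] provides a column or a row free of
    critical grades, and [noncritical_column] shows that a pair of neighbouring stages has no
    relative homology. *)

(** * Vanishing of homology *)

Section Lin.
Variable F : fieldType.

Lemma dim_fullv_eq0P (V : vectType F) :
  reflect (forall x : V, x = 0) (\dim {: V} == 0%N).
Proof.
rewrite dimv_eq0; apply: (iffP idP) => [/eqP V0 x|V0].
  by apply/eqP; rewrite -memv0 -V0 memvf.
by rewrite -subv0; apply/subvP => x _; rewrite (V0 x) mem0v.
Qed.

Lemma homology_eq0P (C : chain_complex F) q :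
  reflect {subset cycles C q <= limg (bd C q)} (\dim {: homology C q} == 0%N).
Proof.
apply: (iffP (dim_fullv_eq0P _)) => [H0 z zC|CB x].
  have /eqP := H0 (qpi (boundaries C q) (vsproj _ z)).
  by rewrite qpi_eq0 -memv_preim lfun_vsval vsprojK.
rewrite -(qreprK x); apply/eqP; rewrite qpi_eq0 -memv_preim lfun_vsval.
by apply: CB; apply: subvsP.
Qed.

End Lin.

(** * Chains as functions on cells, and relative homology *)

Section Chains.
Variables (F : fieldType) (X : cell_complex F).
Implicit Types (A B : {set X}) (c d : {ffun X -> F^o}).

(** All chain groups lie in one space of functions on the cells, so membership is a condition on the
    support. *)
Lemma chainsP A q c :
  reflect (forall s, c s != 0 -> (s \in A) && (cdim s == q)) (c \in chains A q).
Proof.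
set l := [seq cellv t | t <- enum A & cdim t == q].
apply: (iffP idP) => [cl s|cA].
  have /coord_span -> : c \in <<in_tuple l>>%VS by [].
  apply: contraR => nA; rewrite sum_ffunE big1 // => i _.
  have /mapP[t] : (in_tuple l)`_i \in l by rewrite mem_nth ?size_tuple.
  rewrite mem_filter mem_enum andbC => tA ->.
  rewrite ffunE cellvE; case: eqVneq => [E|_]; last by rewrite scaler0.
  by rewrite E tA in nA.
have -> : c = \sum_s c s *: cellv s.
  apply/ffunP => s; rewrite sum_ffunE (bigD1 s) //= big1 => [|t ts].
    by rewrite addr0 ffunE cellvE eqxx /GRing.scale /= mulr1.
  by rewrite ffunE cellvE eq_sym (negPf ts) scaler0.
apply: memv_suml => s _; have [->|/cA/andP[sA /eqP<-]] := eqVneq (c s) 0.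
  by rewrite scale0r mem0v.
by rewrite memvZ // cellv_chains.
Qed.

Lemma chainsI A B q c :
  c \in chains A q -> c \in chains B q -> c \in chains (A :&: B)%SET q.
Proof.
move=> /chainsP cA /chainsP cB; apply/chainsP => s cs.
by have /andP[sA ->] := cA s cs; have /andP[sB _] := cB s cs; rewrite inE sA sB.
Qed.

Lemma chains_set0 q c : c \in chains set0 q -> c = 0.
Proof.
move=> /chainsP c0; apply/ffunP => s; rewrite ffunE.
by apply/eqP; apply: contraT => /c0; rewrite inE.
Qed.

Lemma chains_split A B q c : c \in chains A q -> exists2 c',
  c' \in chains (A :&: B)%SET q & c - c' \in chains (A :\: B)%SET q.
Proof.
move=> /chainsP cA; exists [ffun s => c s *+ (s \in B)].
  apply/chainsP => s; rewrite ffunE inE.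
  by case: (s \in B); rewrite ?eqxx // andbT => /cA.
apply/chainsP => s; rewrite !ffunE inE.
by case: (s \in B); rewrite ?subrr ?eqxx //= subr0 => /cA.
Qed.

Lemma chainsU A B q c : c \in chains (A :|: B)%SET q ->
  exists2 c', c' \in chains A q & c - c' \in chains B q.
Proof.
move=> /(@chains_split _ A)[c' cA cB]; exists c'.
  by apply: subvP cA; rewrite chains_sub ?subsetIr.
apply: subvP cB; rewrite chains_sub //.
by apply/subsetP => s; rewrite !inE; case: (s \in A).
Qed.

(** Stated for incidences only; closure under [face] follows along paths. Bare sets such as
    [sublevel a b] can then be used without packaging them as subcomplexes. *)
Definition face_closed A :=
  forall s t, kappa t s != 0 -> t \in A -> s \in A.

Lemma boundary_deg0 A c : c \in chains A 0 -> boundary X c = 0.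
Proof.
move=> /chainsP c0; rewrite boundaryE big1 // => t _.
have [->|/c0/andP[_ /eqP t0]] := eqVneq (c t) 0; first by rewrite scale0r.
rewrite big1 ?scaler0 // => s _; have [->|] := eqVneq (kappa t s) 0.
  by rewrite scale0r.
by move=> /kappa_dim; rewrite t0.
Qed.

Lemma boundary_closed A q c : face_closed A ->
  c \in chains A q -> boundary X c \in chains A q.-1.
Proof.
move=> clA; case: q => [|q] cA; first by rewrite (boundary_deg0 cA) mem0v.
have clA' s t : face s t -> t \in A -> s \in A.
  move=> /connectP[p + ->]; elim: p s => //= r p IH s /andP[sr rp] /(IH _ rp).
  exact: clA.
by apply: (subvP (boundary_chains (Subcomplex clA') q)); rewrite memv_img.
Qed.

(* Chain-level form of [H_q(B, A) = 0]; the condition on the boundary is void *)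
(* for [q = 0]. *)
Definition rel_exact A B q := forall c, c \in chains B q ->
  boundary X c \in chains A q.-1 ->
  exists2 e, e \in chains B q.+1 & c - boundary X e \in chains A q.

Lemma limg_incl (A B : subcomplex X) (sAB : A \subset B) q
    (x : subvs_of (chains B q)) :
  (x \in limg (incl sAB q)) = (vsval x \in chains A q).
Proof.
apply/memv_imgP/idP => [[y _ ->]|xA].
  by rewrite submapE ?chains_incl // id_lfunE subvsP.
exists (vsproj _ (vsval x)); rewrite ?memvf //; apply: val_inj.
by rewrite /= submapE ?chains_incl // id_lfunE vsprojK.
Qed.

Lemma rel_homology_eq0P (A B : subcomplex X) (sAB : A \subset B) q :
  \dim {: rel_homology sAB q} == 0%N <-> rel_exact A B q.
Proof.
(* A class modulo $A$ is a cycle when the boundary of a representative lies in $A$; in degree 0 both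
   sides hold. *)
have cycE (x : subvs_of (chains B q)) :
    (qpi (limg (incl sAB q)) x \in cycles (quot_complex (incl sAB)) q) =
    (boundary X (vsval x) \in chains A q.-1).
  case: q x => [|q] x /=.
    by rewrite memvf (boundary_deg0 (subvsP x)) mem0v.
  rewrite memv_ker (qmapE _ (quot_bd (incl sAB) q)) qpi_eq0 (limg_incl sAB).
  by rewrite submapE ?boundary_chains.
split=> [/homology_eq0P H c cB dcA|RE].
  have := H (qpi (limg (incl sAB q)) (vsproj _ c)).
  rewrite cycE vsprojK // => /(_ dcA)/memv_imgP[y _ E].
  have /eqP := E; rewrite -(qreprK y) (qmapE _ (quot_bd (incl sAB) q)).
  rewrite -subr_eq0 -linearB /= qpi_eq0 (limg_incl sAB) linearB /=.
  rewrite submapE ?boundary_chains // vsprojK //.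
  by exists (vsval (qrepr _ y)) => //; apply: subvsP.
apply/homology_eq0P => x; rewrite -(qreprK x) cycE => /RE -[|e eB ceA].
  exact: subvsP.
apply/memv_imgP; exists (qpi _ (vsproj _ e)); rewrite ?memvf //.
rewrite (qmapE _ (quot_bd (incl sAB) q)); apply/eqP.
rewrite -subr_eq0 -linearB /= qpi_eq0.
by rewrite (limg_incl sAB) linearB /= submapE ?boundary_chains // vsprojK.
Qed.

End Chains.

Ltac ffun_ring := apply/ffunP => ?; rewrite !ffunE; ring.

(** * Diagram chases on the chains of a sublevel filtration *)

Section KoszulChains.
Variables (F : fieldType) (X : cell_complex F).

(** Cycles and boundaries are taken in the common ambient space, so that inclusions of stages act as
    the identity. *)
Definition zchains (A : {set X}) q := (chains A q :&: lker (boundary X))%VS.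

Definition bchains (A : {set X}) q := (boundary X @: chains A q.+1)%VS.

Lemma zchainsP (A : {set X}) q z :
  reflect (z \in chains A q /\ boundary X z = 0) (z \in zchains A q).
Proof.
rewrite memv_cap memv_ker; apply: (iffP andP) => [] [zA].
  by move/eqP.
by move->.
Qed.

Variables f g : X -> nat.
Hypothesis f_face : forall s t : X, kappa t s != 0 -> (f s <= f t)%N.
Hypothesis g_face : forall s t : X, kappa t s != 0 -> (g s <= g t)%N.

(* With strict bounds, [sublevel a.+1 b.+1] is the stage of grade (a, b), and *)
(* the predecessor stages are the sublevels with a smaller bound, including   *)
(* the empty ones. *)
Definition sublevel a b : {set X} := [set s | (f s < a)%N && (g s < b)%N]%SET.

Lemma sublevel_sub a b a' b' : (a <= a')%N -> (b <= b')%N ->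
  sublevel a b \subset sublevel a' b'.
Proof.
move=> aa bb; apply/subsetP => s; rewrite !inE => /andP[sa sb].
by rewrite (leq_trans sa aa) (leq_trans sb bb).
Qed.

Lemma sublevel_chains a b a' b' q : (a <= a')%N -> (b <= b')%N ->
  {subset chains (sublevel a b) q <= chains (sublevel a' b') q}.
Proof. by move=> aa bb; apply/subvP/chains_sub/sublevel_sub. Qed.

(** The chain form of $X^{u-e_1}\cap X^{u-e_2}=X^{u-e_1-e_2}$, which one-criticality provides. *)
Lemma sublevelI a b q c : c \in chains (sublevel a b.+1) q ->
  c \in chains (sublevel a.+1 b) q -> c \in chains (sublevel a b) q.
Proof.
move=> cA /(chainsI cA); apply: subvP; apply: chains_sub.
by apply/subsetP => s; rewrite !inE => /andP[/andP[-> _] /andP[_ ->]].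
Qed.

Lemma sublevel_face a b : face_closed (sublevel a b).
Proof.
move=> s t kts; rewrite !inE => /andP[ta tb].
by rewrite (leq_ltn_trans (f_face kts) ta) (leq_ltn_trans (g_face kts) tb).
Qed.

Definition lower a b : {set X} := (sublevel a b.+1 :|: sublevel a.+1 b)%SET.

Definition noncritical q a b :=
  rel_exact (lower a b) (sublevel a.+1 b.+1) q.

(** This and the next two conditions are [koszul0], [koszul1] and [koszul2] for $V_q$ in grade
    $(a,b)$, written with representing cycles. *)
Definition koszul_chain0 q a b := forall z,
  z \in zchains (sublevel a.+1 b.+1) q ->
  exists z1 z2, [/\ z1 \in zchains (sublevel a b.+1) q,
    z2 \in zchains (sublevel a.+1 b) q &
    z - (z1 + z2) \in bchains (sublevel a.+1 b.+1) q].

Definition koszul_chain1 q a b := forall z1 z2,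
  z1 \in zchains (sublevel a b.+1) q -> z2 \in zchains (sublevel a.+1 b) q ->
  z1 + z2 \in bchains (sublevel a.+1 b.+1) q ->
  exists z0, [/\ z0 \in zchains (sublevel a b) q,
    z1 - z0 \in bchains (sublevel a b.+1) q &
    z2 + z0 \in bchains (sublevel a.+1 b) q].

Definition koszul_chain2 q a b := forall z, z \in zchains (sublevel a b) q ->
  z \in bchains (sublevel a b.+1) q -> z \in bchains (sublevel a.+1 b) q ->
  z \in bchains (sublevel a b) q.

(* The spectral sequence of the Koszul double complex, run by hand. *)
Lemma noncritical_koszul q a b : koszul_chain0 q a b ->
  (forall p, q = p.+1 -> koszul_chain1 p a b) ->
  (forall p, q = p.+2 -> koszul_chain2 p a b) -> noncritical q a b.
Proof.
move=> K0 K1 K2 c cL dcS.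
have sl := sublevel_chains.
have [e1 [e2 [e1L e2L dE]]] : exists e1 e2,
    [/\ e1 \in chains (sublevel a b.+1) q, e2 \in chains (sublevel a.+1 b) q &
      boundary X (c - (e1 + e2)) = 0].
  case: q K1 K2 dcS cL {K0} => [|q] K1 K2 dcS cL.
    by exists 0, 0; rewrite !mem0v addr0 subr0 (boundary_deg0 cL).
  (* Split $\partial c=a_1+a_2$ over the two predecessors; $\partial a_1=-\partial a_2$ lies in
     their intersection and bounds in each of them. *)
  have /= [a1 a1L a2L] := chainsU dcS; set a2 := _ - a1 in a2L.
  have da : boundary X a2 = - boundary X a1.
    by rewrite linearB /= boundary_boundary sub0r.
  (* By [K2] it bounds in the intersection too. If $a_1$ has degree 0, then $a_0=0$ works. *)
  have [a0 a0L da0] : exists2 a0, a0 \in chains (sublevel a b) q &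
      boundary X a1 = boundary X a0.
    case: q {K1 cL dcS} K2 a1L a2L => [|q] K2 a1L a2L.
      by exists 0; rewrite ?mem0v // linear0 (boundary_deg0 a1L).
    have [] // := memv_imgP (K2 q erefl (boundary X a1) _ _ _).
    - apply/zchainsP; rewrite boundary_boundary; split=> //; apply: sublevelI.
        exact: boundary_closed (@sublevel_face _ _) a1L.
      by rewrite -memvN -da; apply: boundary_closed (@sublevel_face _ _) a2L.
    - exact: memv_img.
    - by rewrite -memvN -da memv_img.
    - by move=> y yL E; exists y.
  (* These are cycles with sum $\partial c$, so [K1] makes each of them bound in its predecessor up
     to a cycle $z_0$ of the intersection, with opposite signs. *)
  have [] := K1 q erefl (a1 - a0) (a2 + a0) _ _ _.
  - apply/zchainsP; rewrite linearB /= da0 subrr; split=> //.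
    by rewrite memvB // (sl _ _ _ _ _ _ _ _ a0L).
  - apply/zchainsP; rewrite linearD /= da da0 addNr; split=> //.
    by rewrite memvD // (sl _ _ _ _ _ _ _ _ a0L).
  - by rewrite addrACA addNr addr0 addrC subrK memv_img.
  - move=> z0 [_ /memv_imgP[e1 e1L E1] /memv_imgP[e2 e2L E2]].
    exists e1, e2; split=> //; rewrite linearB linearD /= -E1 -E2.
    by rewrite addrACA addNr addr0 [_ + a0]addrC addrA subrK addrC subrK subrr.
have eL : e1 + e2 \in chains (sublevel a.+1 b.+1) q.
  by rewrite memvD // ?(sl _ _ _ _ _ _ _ _ e1L) ?(sl _ _ _ _ _ _ _ _ e2L).
have [|z1 [z2 [/zchainsP[z1L _] /zchainsP[z2L _] /memv_imgP[e eL' E]]]] :=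
    K0 (c - (e1 + e2)).
  by apply/zchainsP; rewrite memvB.
exists e => //; have -> : c - boundary X e = (z1 + e1) + (z2 + e2).
  rewrite -E; ffun_ring.
apply: memvD.
  by apply: (subvP (chains_sub _ (subsetUl _ _))); apply: memvD.
by apply: (subvP (chains_sub _ (subsetUr _ _))); apply: memvD.
Qed.

(** A chain bounding $z_1+z_2$ is a relative cycle, hence equals $d_1+d_2$ up to a boundary, with
    $d_i$ in the predecessors. Then $z_1-\partial d_1=-(z_2-\partial d_2)$ lies in both predecessors
    and serves as $z_0$. *)
Lemma koszul1_noncritical q a b : noncritical q.+1 a b -> koszul_chain1 q a b.
Proof.
move=> nc z1 z2 /zchainsP[z1L dz1] /zchainsP[z2L dz2] /memv_imgP[d dL zE].
have [||e eL /chainsU[d1 d1L d2L]] := nc d => //.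
  rewrite -zE; apply: memvD.
    by apply: (subvP (chains_sub _ (subsetUl _ _))).
  by apply: (subvP (chains_sub _ (subsetUr _ _))).
set d2 := _ - d1 in d2L.
have dE : boundary X d2 = z1 + z2 - boundary X d1.
  by rewrite !linearB /= boundary_boundary subr0 -zE.
have zE' : z1 - boundary X d1 = - (z2 - boundary X d2).
  by rewrite dE; ffun_ring.
exists (z1 - boundary X d1); split.
- apply/zchainsP; rewrite linearB /= boundary_boundary dz1 subr0; split=> //.
  apply: sublevelI; last rewrite zE' memvN.
    by rewrite memvB // (boundary_closed (@sublevel_face _ _) d1L).
  by rewrite memvB // (boundary_closed (@sublevel_face _ _) d2L).
- by rewrite subKr memv_img.
- by rewrite zE' opprB addrC subrK memv_img.
Qed.

(** Induction on the height of the column. Noncriticality at the top moves a relative cycle into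
    [lower], where it splits into a chain of [sublevel a b.+1] and a relative cycle one step
    lower. *)
Lemma noncritical_column q a b : (forall j, (j < b)%N -> noncritical q a j) ->
  rel_exact (sublevel a b) (sublevel a.+1 b) q.
Proof.
elim: b => [|b IH] nc c cL dcL.
  have -> : c = 0.
    apply: (@chains_set0 _ _ q); apply: subvP cL; apply: chains_sub.
    by apply/subsetP => s; rewrite !inE ltn0 andbF.
  by exists 0; rewrite ?mem0v // linear0 subrr mem0v.
have [||e eL /chainsU[c1 c1L c2L]] := nc b (ltnSn b) c => //.
  by apply: (subvP (chains_sub _ (subsetUl _ _))).
set c2 := _ - c1 in c2L.
have [||e' eL' ce'] := IH _ c2 c2L.
- by move=> j jb; apply: nc; apply: ltnW.
(* $\partial c_2=\partial c-\partial c_1$ lies in both predecessors, so $c_2$ is a relative cycle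
   for the shorter column. *)
- apply: sublevelI; last exact: boundary_closed (@sublevel_face _ _) c2L.
  rewrite !linearB /= boundary_boundary subr0 memvB //.
  exact: boundary_closed (@sublevel_face _ _) c1L.
exists (e + e'); first by rewrite memvD // (sublevel_chains _ _ eL').
have -> : c - boundary X (e + e') = c1 + (c2 - boundary X e').
  by rewrite linearD /= /c2; ffun_ring.
by rewrite memvD // (sublevel_chains _ _ ce').
Qed.

(** $H_q(X^{u-e_1})\to H_q(X^u)$ is onto, so the second summand can be 0. *)
Lemma column_koszul0 q a b : (forall j, (j <= b)%N -> noncritical q a j) ->
  koszul_chain0 q a b.
Proof.
move=> nc z /zchainsP[zL dz].
have [//||e eL ze] := @noncritical_column q a b.+1 nc z.
  by rewrite dz mem0v.
exists (z - boundary X e), 0; rewrite mem0v addr0 subKr memv_img //; split=> //.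
by apply/zchainsP; rewrite linearB /= boundary_boundary dz subr0.
Qed.

(** $H_q(X^{u-e_1-e_2})\to H_q(X^{u-e_2})$ is injective, since $H_{q+1}$ of this pair vanishes. *)
Lemma column_koszul2 q a b : (forall j, (j <= b)%N -> noncritical q.+1 a j) ->
  koszul_chain2 q a b.
Proof.
move=> nc z /zchainsP[zL dz] _ /memv_imgP[d dL zE].
have [//||e eL ze] :=
    @noncritical_column q.+1 a b (fun j jb => nc j (ltnW jb)) d.
  by rewrite -zE.
apply/memv_imgP; exists (d - boundary X e) => //.
by rewrite linearB /= boundary_boundary subr0.
Qed.

End KoszulChains.

(** * The Koszul complex of a 2-graded module *)

Section Koszul.
Variable F : fieldType.
Implicit Types M N P : gmod F.

(* Modules are extended by zero to the index [None], a grade below all grades *)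
(* that stands for every element of Z^2 outside N^2. *)
Definition epart M (o : option grade) : vectType F :=
  if o is Some u then M u else 'rV[F]_0.

Definition ole (o p : option grade) : bool :=
  match o, p with
  | None, _ => true
  | Some u, Some v => (u <= v)%O
  | _, None => false
  end.

Definition emul M o p : 'Hom(epart M o, epart M p) :=
  match o, p with
  | Some u, Some v => xmul M u v
  | _, _ => 0
  end.

Definition efun M N (f : gmor M N) o : 'Hom(epart M o, epart N o) :=
  if o is Some u then f u else 0.

Lemma epart_None M (x y : epart M None) : x = y.
Proof. exact: (etrans (thinmx0 x) (esym (thinmx0 y))). Qed.

Lemma emul_comp M o p r x : ole o p -> ole p r ->
  emul M p r (emul M o p x) = emul M o r x.
Proof.
case: o x => [u|] x; last by rewrite (epart_None x 0) !linear0.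
case: p r => [v|] // [w|] //= uv vw.
by rewrite -comp_lfunE xmul_comp.
Qed.

Lemma efun_emul M N (f : gmor M N) o p x : ole o p ->
  efun f p (emul M o p x) = emul N o p (efun f o x).
Proof.
case: o x => [u|] x; last by rewrite (epart_None x 0) !linear0.
by case: p => [v|] //= uv; rewrite -!comp_lfunE gfun_xmul.
Qed.

Definition epred1 (u : grade) : option grade :=
  if u is (a.+1, b) then Some (a, b) else None.

Definition epred2 (u : grade) : option grade :=
  if u is (a, b.+1) then Some (a, b) else None.

Definition epred12 (u : grade) : option grade :=
  if u is (a.+1, b.+1) then Some (a, b) else None.

Lemma epred1_le u : ole (epred1 u) (Some u).
Proof. by case: u => -[|a] b //=; apply: grade_le1. Qed.

Lemma epred2_le u : ole (epred2 u) (Some u).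
Proof. by case: u => a [|b] //=; apply: grade_le2. Qed.

Lemma epred12_le1 u : ole (epred12 u) (epred1 u).
Proof. by case: u => -[|a] [|b] //=; apply: grade_le2. Qed.

Lemma epred12_le2 u : ole (epred12 u) (epred2 u).
Proof. by case: u => -[|a] [|b] //=; apply: grade_le1. Qed.

Lemma ole_epred12 u w :
  ole (Some w) (epred1 u) -> ole (Some w) (epred2 u) ->
  ole (Some w) (epred12 u).
Proof.
case: u w => -[|a] [|b] // [w1 w2] /=; rewrite !leEprod /=.
by move=> /andP[-> _] /andP[_ ->].
Qed.

(* Exactness at the three places of the Koszul complex of M in grade u, that  *)
(* is of M(u - e1 - e2) -> M(u - e1) (+) M(u - e2) -> M(u).                   *)
Definition koszul0 M (u : grade) := forall m : epart M (Some u), exists m1 m2,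
  m = emul M (epred1 u) (Some u) m1 + emul M (epred2 u) (Some u) m2.

Definition koszul1 M (u : grade) := forall m1 m2,
  emul M (epred1 u) (Some u) m1 + emul M (epred2 u) (Some u) m2 = 0 ->
  exists2 m0, m1 = emul M (epred12 u) (epred1 u) m0 &
              m2 = - emul M (epred12 u) (epred2 u) m0.

Definition koszul2 M (u : grade) := forall m,
  emul M (epred12 u) (epred1 u) m = 0 -> emul M (epred12 u) (epred2 u) m = 0 ->
  m = 0.

Lemma irrelevantP M u m :
  reflect (exists m1 m2,
      m = emul M (epred1 u) (Some u) m1 + emul M (epred2 u) (Some u) m2)
    (m \in irrelevant M u).
Proof.
apply: (iffP memv_addP) => [[x xI [y yI ->{m}]]|[m1 [m2 ->{m}]]].
  have [m1 ->] : exists m1, x = emul M (epred1 u) (Some u) m1.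
    case: u {y yI} x xI => -[|a] b x /=.
      by rewrite memv0 => /eqP->; exists 0; rewrite linear0.
    by move=> /memv_imgP[m1 _ ->]; exists m1.
  have [m2 ->] : exists m2, y = emul M (epred2 u) (Some u) m2.
    case: u {x xI m1} y yI => a [|b] y /=.
      by rewrite memv0 => /eqP->; exists 0; rewrite linear0.
    by move=> /memv_imgP[m2 _ ->]; exists m2.
  by exists m1, m2.
exists (emul M (epred1 u) (Some u) m1).
  case: u m1 {m2} => -[|a] b m1 /=; first by rewrite zero_lfunE mem0v.
  by rewrite memv_img ?memvf.
exists (emul M (epred2 u) (Some u) m2) => //.
case: u m2 {m1} => a [|b] m2 /=; first by rewrite zero_lfunE mem0v.
by rewrite memv_img ?memvf.
Qed.

(** * Koszul exactness of free modules *)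

Section Free.
Variable beta : grade -> nat.

(** Indexing by a grade and a number, with value 0 where there is no generator, avoids the dependent
    type [gens beta u]. Monomials preserve these coefficients ([ecoef_emul]), so elements of
    different grades can be compared. *)
Definition coef u (c : {ffun gens beta u -> F^o}) (w : grade) (i : nat) : F :=
  \sum_(g : gens beta u | (gen_grade g == w) && (gen_index g == i)) c g.

Definition ecoef o : epart (gfree F beta) o -> grade -> nat -> F :=
  if o is Some u then @coef u else fun _ _ _ => 0.

Lemma coef_gen u (c : {ffun gens beta u -> F^o}) (g : gens beta u) :
  coef c (gen_grade g) (gen_index g) = c g.
Proof. by rewrite /coef (big_pred1 g) // => h /=; rewrite -same_genE. Qed.

Lemma ecoef_inj o (x y : epart (gfree F beta) o) :
  (forall w i, ecoef x w i = ecoef y w i) -> x = y.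
Proof.
case: o x y => [u|] x y E; last exact: epart_None.
by apply/ffunP => g; rewrite -!coef_gen; apply: E.
Qed.

Lemma ecoefD o (x y : epart (gfree F beta) o) w i :
  ecoef (x + y) w i = ecoef x w i + ecoef y w i.
Proof.
case: o x y => [u|] x y /=; last by rewrite addr0.
by rewrite /coef -big_split /=; apply: eq_bigr => g _; rewrite ffunE.
Qed.

Lemma ecoefN o (x : epart (gfree F beta) o) w i :
  ecoef (- x) w i = - ecoef x w i.
Proof.
case: o x => [u|] x /=; last by rewrite oppr0.
by rewrite /coef -sumrN; apply: eq_bigr => g _; rewrite ffunE.
Qed.

Lemma ecoef0 o w i : ecoef (0 : epart (gfree F beta) o) w i = 0.
Proof. by rewrite -[0 in LHS](subrr 0) ecoefD ecoefN subrr. Qed.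

Lemma ecoef_emul o p (x : epart (gfree F beta) o) w i : ole o p ->
  ecoef (emul (gfree F beta) o p x) w i = ecoef x w i.
Proof.
case: o x => [u|] x; last by rewrite (epart_None x 0) linear0 !ecoef0.
case: p => [v|] //= uv; rewrite /coef.
under eq_bigr => h _ do rewrite free_xmulE.
rewrite (exchange_big_dep
  (fun g => (gen_grade g == w) && (gen_index g == i))) /=.
  apply: eq_bigr => g /andP[/eqP gw /eqP gi].
  have [h gh] := same_gen_exists g uv.
  rewrite (big_pred1 h) // => h' /=; rewrite -same_genE.
  move: gh => /andP[/eqP E1 /eqP E2]; rewrite /same_gen -E1 -E2 gw gi.
  by rewrite [w == _]eq_sym [i == _]eq_sym andbb.
by move=> h g /andP[/eqP <- /eqP <-].
Qed.

Lemma ecoef_supp o (x : epart (gfree F beta) o) w i : ecoef x w i != 0 ->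
  ole (Some w) o && (i < beta w)%N.
Proof.
case: o x => [u|] x /=; last by rewrite eqxx.
apply: contraR => nwi; rewrite /coef big1 // => g /andP[/eqP gw /eqP gi].
case/negP: nwi; rewrite -gw gen_grade_le -gi /=; exact: ltn_ord.
Qed.

Lemma ecoef_ex o (phi : grade -> nat -> F) :
    (forall w i, phi w i != 0 -> ole (Some w) o && (i < beta w)%N) ->
  exists x : epart (gfree F beta) o, forall w i, ecoef x w i = phi w i.
Proof.
case: o => [u|] phi_supp; last first.
  by exists 0 => w i; apply/esym/eqP; apply: contraT => /phi_supp.
exists ([ffun g => phi (gen_grade g) (gen_index g)]
  : {ffun gens beta u -> F^o}).
move=> w i /=; have [pwi|/phi_supp/andP[wu ib]] := eqVneq (phi w i) 0.
  by rewrite /coef big1 ?pwi // => g /andP[/eqP gw /eqP gi];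
    rewrite ffunE gw gi.
move: (wu) => /=; rewrite leEprod => /andP[wu1 wu2].
have ib' : (i < beta (w.1, w.2))%N by rewrite -surjective_pairing.
pose v : 'I_u.1.+1 * 'I_u.2.+1 :=
  (Ordinal (wu1 : (w.1 < u.1.+1)%N), Ordinal (wu2 : (w.2 < u.2.+1)%N)).
pose g : gens beta u :=
  Tagged (fun w : 'I_u.1.+1 * 'I_u.2.+1 => 'I_(beta (val w.1, val w.2)))
    (Ordinal ib' : 'I_(beta (val v.1, val v.2))).
have gw : gen_grade g = w by rewrite [RHS]surjective_pairing.
have -> : i = gen_index g by [].
by rewrite -gw coef_gen ffunE.
Qed.

(** The coefficients of $m_1$ and $m_2$ are opposite, so they live on generators below both $u-e_1$
    and $u-e_2$, hence below $u-e_1-e_2$; there $m_0$ takes the coefficients of $m_1$. *)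
Lemma free_koszul1 u : koszul1 (gfree F beta) u.
Proof.
move=> m1 m2 m12.
have E w i : ecoef m1 w i = - ecoef m2 w i.
  apply/eqP; rewrite -addr_eq0 -(ecoef_emul _ _ _ (epred1_le u)).
  by rewrite -(ecoef_emul m2 _ _ (epred2_le u)) -ecoefD m12 ecoef0.
have [|m0 m0E] := @ecoef_ex (epred12 u) (ecoef m1).
  move=> w i m1wi; have /andP[w1 ->] := ecoef_supp m1wi; rewrite andbT.
  apply: ole_epred12 => //; move: m1wi; rewrite E oppr_eq0.
  by move=> /ecoef_supp/andP[].
exists m0; apply: ecoef_inj => w i.
  by rewrite ecoef_emul ?epred12_le1 // m0E.
by rewrite ecoefN ecoef_emul ?epred12_le2 // m0E E opprK.
Qed.

Lemma free_koszul2 u : koszul2 (gfree F beta) u.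
Proof.
move=> m m1 _; apply: ecoef_inj => w i.
by rewrite -(ecoef_emul m _ _ (epred12_le1 u)) m1 !ecoef0.
Qed.

End Free.

Arguments epart : simpl never.
Arguments emul : simpl never.
Arguments efun : simpl never.

(** * Dimension shifting along a short exact sequence *)

Section ShortExact.
Variables (N P M : gmod F) (iota : gmor N P) (eps : gmor P M) (u : grade).
Hypothesis iota_inj : forall v, lker (iota v) = 0%VS.
Hypothesis eps_surj : forall v, limg (eps v) = fullv.
Hypothesis iota_eps : forall v, limg (iota v) = lker (eps v).

Lemma efun_inj o : injective (efun iota o).
Proof.
case: o => [v|] x y; last by move=> _; apply: epart_None.
by move: x y; apply/lker0P; rewrite /efun iota_inj.
Qed.

Lemma efun_surj o m : exists p, m = efun eps o p.
Proof.
case: o m => [v|] m; last by exists 0; apply: epart_None.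
have /memv_imgP[p _ ->] : m \in limg (eps v) by rewrite eps_surj memvf.
by exists p.
Qed.

Lemma efun_exact o p : efun eps o p = 0 -> exists n, p = efun iota o n.
Proof.
case: o p => [v|] p; rewrite /efun; last by exists 0; apply: epart_None.
move=> /eqP; rewrite -memv_ker -iota_eps => /memv_imgP[n _ ->]; by exists n.
Qed.

Lemma efun_comp0 o n : efun eps o (efun iota o n) = 0.
Proof.
case: o n => [v|] n; rewrite /efun; last by apply: epart_None.
by apply/eqP; rewrite -memv_ker -iota_eps memv_img ?memvf.
Qed.

(** The exact sequence $0=H_1(P)\to H_1(M)\to H_0(N)\to H_0(P)$ of Koszul homology: the right side
    is injectivity of the last map. *)
Lemma koszul1_shift : koszul1 P u ->
  koszul1 M u <->
  (forall n : epart N (Some u), efun iota (Some u) n \in irrelevant P u ->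
     n \in irrelevant N u).
Proof.
have [le1 le2] := (epred1_le u, epred2_le u).
have [le01 le02] := (epred12_le1 u, epred12_le2 u).
move=> KP; split=> [KM n /irrelevantP[p1 [p2 nE]]|IN m1 m2 mE].
  have [m0 E1 E2] : exists2 m0,
      efun eps (epred1 u) p1 = emul M (epred12 u) (epred1 u) m0 &
      efun eps (epred2 u) p2 = - emul M (epred12 u) (epred2 u) m0.
    by apply: KM; rewrite -!efun_emul // -linearD -nE /= efun_comp0.
  have [p0 m0E] := efun_surj m0; rewrite m0E in E1 E2.
  have [|n1 n1E] := @efun_exact _ (p1 - emul P (epred12 u) (epred1 u) p0).
    by rewrite linearB /= efun_emul // E1 subrr.
  have [|n2 n2E] := @efun_exact _ (p2 + emul P (epred12 u) (epred2 u) p0).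
    by rewrite linearD /= efun_emul // E2 addNr.
  apply/irrelevantP; exists n1, n2; apply: (@efun_inj (Some u)).
  rewrite linearD /= !(efun_emul iota) // -n1E -n2E linearB linearD /=.
  by rewrite !emul_comp // addrACA addNr addr0 nE.
have [p1 m1E] := efun_surj m1; have [p2 m2E] := efun_surj m2.
have [|n nE] := @efun_exact (Some u)
    (emul P (epred1 u) (Some u) p1 + emul P (epred2 u) (Some u) p2).
  by rewrite linearD /= !(efun_emul eps) // -m1E -m2E.
have /IN/irrelevantP[n1 [n2 nE']] : efun iota (Some u) n \in irrelevant P u.
  by apply/irrelevantP; exists p1, p2.
have [|p0 p1E p2E] := KP (p1 - efun iota _ n1) (p2 - efun iota _ n2).
  rewrite !linearB /= -!(efun_emul iota) // addrACA nE -opprD -linearD -nE'.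
  by rewrite subrr.
exists (efun eps _ p0).
  by rewrite -(efun_emul eps) // -p1E linearB /= efun_comp0 subr0.
by rewrite -(efun_emul eps) // -linearN -p2E linearB /= efun_comp0 subr0.
Qed.

(** The exact sequence $0=H_2(P)\to H_2(M)\to H_1(N)\to H_1(P)=0$. *)
Lemma koszul2_shift : koszul1 P u -> koszul2 P u -> koszul2 M u <-> koszul1 N u.
Proof.
have [le1 le2] := (epred1_le u, epred2_le u).
have [le01 le02] := (epred12_le1 u, epred12_le2 u).
move=> KP1 KP2; split=> [KM n1 n2 nE|KN m E1 E2].
  have [|p0 E1 E2] := KP1 (efun iota _ n1) (efun iota _ n2).
    by rewrite -!(efun_emul iota) // -linearD nE linear0.
  have /efun_exact[n0 n0E] : efun eps _ p0 = 0.
    apply: KM; rewrite -(efun_emul eps) //; first by rewrite -E1 efun_comp0.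
    by apply/eqP; rewrite -oppr_eq0 -linearN /= -E2 efun_comp0.
  by exists n0; apply: efun_inj; rewrite ?linearN /= (efun_emul iota) // -n0E.
have [p mE] := efun_surj m; rewrite mE -!(efun_emul eps) // in E1 E2.
have [n1 n1E] := efun_exact E1; have [n2 n2E] := efun_exact E2.
have [|n0 E01 E02] := KN n1 (- n2).
  apply: (@efun_inj (Some u)); rewrite linear0 linearD /= !(efun_emul iota) //.
  by rewrite linearN linearN /= -n1E -n2E !emul_comp // subrr.
have -> : m = efun eps _ (p - efun iota _ n0) + efun eps _ (efun iota _ n0).
  by rewrite -linearD subrK.
rewrite efun_comp0 addr0; have -> : p - efun iota _ n0 = 0; last exact: linear0.
apply: KP2; rewrite linearB /= -(efun_emul iota) //.
  by rewrite -E01 -n1E subrr.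
by rewrite -[emul N _ _ n0]opprK -E02 opprK -n2E subrr.
Qed.

End ShortExact.

(** * Tor as Koszul homology *)

Section Tor.
Variables (M : gmod F) (u : grade).

Lemma torK_eq0P i : \dim {: torK M i u} == 0%N <->
  {subset cycles (torK_complex M u) i <= limg (tensK_map (res_d M i) u)}.
Proof. by split=> [/homology_eq0P|/homology_eq0P]. Qed.

(** Right exactness of the tensor product: the cokernel of the tensored differential is the tensored
    syzygy. *)
Lemma tensK_img i (p : res M i u) :
  (qpi (irrelevant (res M i) u) p \in limg (tensK_map (res_d M i) u)) =
  (Defs.cover (syz M i) u p \in irrelevant (syz M i) u).
Proof.
apply/memv_imgP/idP => [[y _]|].
  rewrite -(qreprK y) qmapE ?irrelevant_map // => /eqP.
  rewrite -subr_eq0 -linearB /= qpi_eq0 => pI.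
  set y' := qrepr _ y in pI.
  have <- : Defs.cover (syz M i) u (p - res_d M i u y') =
      Defs.cover (syz M i) u p.
    have : res_d M i u y' \in limg (res_d M i u) by rewrite memv_img ?memvf.
    rewrite res_d_img memv_ker => /eqP y'0.
    by rewrite linearB -[RHS]subr0; congr (_ - _).
  apply: (subvP (irrelevant_map (Defs.cover (syz M i)) u)).
  exact: memv_img.
move=> /irrelevantP[z1 [z2 pE]].
have surj := efun_surj (@cover_surj _ (syz M i)).
have [p1 z1E] := surj _ z1; have [p2 z2E] := surj _ z2.
have : p - (emul (res M i) (epred1 u) (Some u) p1 +
            emul (res M i) (epred2 u) (Some u) p2) \in limg (res_d M i u).
  rewrite res_d_img memv_ker linearB linearD /=.
  have /= E1 := efun_emul (Defs.cover (syz M i)) p1 (epred1_le u).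
  have /= E2 := efun_emul (Defs.cover (syz M i)) p2 (epred2_le u).
  by rewrite E1 E2 -z1E -z2E pE subrr.
move=> /memv_imgP[y _ yE]; exists (qpi _ y); first exact: memvf.
rewrite qmapE ?irrelevant_map //; apply/eqP.
rewrite -subr_eq0 -linearB /= qpi_eq0.
rewrite -yE subKr.
by apply: (introT (@irrelevantP (res M i) u _)); exists p1, p2.
Qed.

Lemma tor0_koszul : \dim {: torK M 0 u} == 0%N <-> koszul0 M u.
Proof.
rewrite torK_eq0P; split=> [T m|K x _].
  have /memv_imgP[p _ ->] : m \in limg (Defs.cover M u).
    by rewrite cover_surj memvf.
  by apply/irrelevantP; rewrite -(tensK_img (i := 0)) T // memvf.
by rewrite -(qreprK x) tensK_img; apply/irrelevantP/K.
Qed.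

(** The differential factors through the syzygy, so Tor in degree $i+1$ is the kernel of the
    tensored inclusion of that syzygy into [res M i]. *)
Lemma torS_syz i : \dim {: torK M i.+1 u} == 0%N <->
  (forall n, gker_incl (Defs.cover (syz M i)) u n \in irrelevant (res M i) u ->
     n \in irrelevant (syz M i.+1) u).
Proof.
have cycE (p : res M i.+1 u) :
    (qpi (irrelevant (res M i.+1) u) p \in cycles (torK_complex M u) i.+1) =
    (gker_incl (Defs.cover (syz M i)) u (Defs.cover (syz M i.+1) u p)
       \in irrelevant (res M i) u).
  rewrite memv_ker (qmapE _ (irrelevant_map (res_d M i) u)) qpi_eq0.
  by rewrite [X in X \in _]comp_lfunE.
rewrite torK_eq0P; split=> [T n nI|S x].
  have /memv_imgP[p _ nE] : n \in limg (Defs.cover (syz M i.+1) u).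
    by rewrite cover_surj memvf.
  by rewrite nE -(tensK_img (i := i.+1) p) T // cycE -nE.
by rewrite -(qreprK x) cycE tensK_img => /S.
Qed.

End Tor.

Lemma ker_gker_incl M N (f : gmor M N) v : lker (gker_incl f v) = 0%VS.
Proof.
by apply/eqP/lker0P => x y; rewrite !lfun_vsval; apply: val_inj.
Qed.

Lemma img_gker_incl M N (f : gmor M N) v : limg (gker_incl f v) = lker (f v).
Proof.
apply/vspaceP => x; apply/memv_imgP/idP => [[y _ ->]|xK].
  by rewrite lfun_vsval subvsP.
by exists (vsproj _ x); rewrite ?memvf // lfun_vsval vsprojK.
Qed.

Lemma torS_koszul M i u :
  \dim {: torK M i.+1 u} == 0%N <-> koszul1 (syz M i) u.
Proof.
rewrite torS_syz; symmetry.
apply: (koszul1_shift (ker_gker_incl (Defs.cover (syz M i))) (@cover_surj _ _)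
  (img_gker_incl (Defs.cover (syz M i)))).
exact: free_koszul1.
Qed.

Lemma tor1_koszul M u : \dim {: torK M 1 u} == 0%N <-> koszul1 M u.
Proof. exact: torS_koszul. Qed.

(** Tor in degree 2 is the middle Koszul homology of the first syzygy, which one more shift turns
    into the left-hand one of $M$. *)
Lemma tor2_koszul M u : \dim {: torK M 2 u} == 0%N <-> koszul2 M u.
Proof.
rewrite torS_koszul; symmetry.
apply: (koszul2_shift (ker_gker_incl (Defs.cover M)) (@cover_surj _ _)
  (img_gker_incl (Defs.cover M))); [exact: free_koszul1|exact: free_koszul2].
Qed.

End Koszul.

Arguments epart : simpl never.
Arguments emul : simpl never.

(** * Homology classes of cycles *)

Section HomologyClass.
Variables (F : fieldType) (X : cell_complex F).
Implicit Types A B : subcomplex X.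

(* The class of a cycle; meaningful on [zchains A q] only. *)
Definition hclass A q : 'Hom({ffun X -> F^o}, homology (cellular A) q) :=
  (qpi (boundaries (cellular A) q) \o
     (linfun (vsproj (cycles (cellular A) q)) \o
        linfun (vsproj (chains A q))))%VF.

Lemma hclassE A q z : hclass A q z =
  qpi (boundaries (cellular A) q) (vsproj _ (vsproj (chains A q) z)).
Proof. by rewrite !comp_lfunE !lfunE. Qed.

Lemma cycles_cellular A q z : z \in zchains A q ->
  vsproj (chains A q) z \in cycles (cellular A) q.
Proof.
case: q => [|q] /zchainsP[zA dz]; first by rewrite memvf.
rewrite memv_ker; apply/eqP/val_inj.
by rewrite /= submapE ?boundary_chains // vsprojK.
Qed.

Lemma hclass_surj A q x : exists2 z, z \in zchains A q & x = hclass A q z.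
Proof.
rewrite -(qreprK x); set y := qrepr _ x; exists (vsval (vsval y)).
  apply/zchainsP; split; first exact: subvsP.
  case: q x @y => [|q] x y; first exact: boundary_deg0 (subvsP _).
  have := subvsP y; rewrite memv_ker => /eqP/(congr1 vsval).
  by rewrite /= submapE ?boundary_chains.
by rewrite hclassE !vsvalK.
Qed.

Lemma hclass_eq0 A q z : z \in zchains A q ->
  (hclass A q z == 0) = (z \in bchains A q).
Proof.
move=> zZ; have /zchainsP[zA _] := zZ.
rewrite hclassE qpi_eq0 -memv_preim lfun_vsval vsprojK ?cycles_cellular //.
apply/memv_imgP/memv_imgP => [[d _ E]|[d dA E]].
  exists (vsval d); first exact: subvsP.
  by rewrite -[z in LHS](vsprojK zA) E /= submapE ?boundary_chains.
exists (vsproj _ d); rewrite ?memvf //; apply: val_inj.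
by rewrite /= submapE ?boundary_chains // !vsprojK.
Qed.

Lemma hclass_incl A B (sAB : A \subset B) q z : z \in zchains A q ->
  hmap (incl sAB) q (hclass A q z) = hclass B q z.
Proof.
move=> zZ; have /zchainsP[zA dz] := zZ.
have zB : z \in zchains B q.
  by apply/zchainsP; split=> //; apply: (subvP (chains_sub _ sAB)).
rewrite !hclassE /hmap (qmapE _ (cmap_boundaries (incl sAB) q)).
congr (qpi _ _); apply: val_inj.
rewrite [LHS](submapE _ (cmap_cycles (incl sAB) q)).
rewrite (vsprojK (cycles_cellular zZ)).
apply: etrans (esym (vsprojK (cycles_cellular zB))); apply: val_inj.
 have /zchainsP[zB' _] := zB.
by rewrite /= submapE ?chains_incl // id_lfunE !vsprojK.
Qed.

End HomologyClass.

(** * Koszul exactness of $V_q$ in terms of chains *)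

Section KoszulPersistence.
Variables (F : fieldType) (X : cell_complex F) (Xf : bifiltration X).
Variable h : X -> grade.
Hypothesis Xf_h : forall u, Xf u = [set s | (h s <= u)%O] :> {set X}.

Notation lev := (sublevel (fun s => (h s).1) (fun s => (h s).2)).

Definition estage (o : option grade) : {set X} :=
  if o is Some u then Xf u : {set X} else set0.

Lemma stage_sublevel a b : Xf (a, b) = lev a.+1 b.+1 :> {set X}.
Proof. by rewrite Xf_h; apply/setP => s; rewrite !inE leEprod. Qed.

Lemma sublevel0l b : lev 0 b = set0.
Proof. by apply/setP => s; rewrite !inE. Qed.

Lemma sublevel0r a : lev a 0 = set0.
Proof. by apply/setP => s; rewrite !inE ltn0 andbF. Qed.

Lemma sublevel_epred1 u : lev u.1 u.2.+1 = estage (epred1 u).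
Proof. by case: u => -[|a] b; rewrite ?sublevel0l //= stage_sublevel. Qed.

Lemma sublevel_epred2 u : lev u.1.+1 u.2 = estage (epred2 u).
Proof. by case: u => a [|b]; rewrite ?sublevel0r //= stage_sublevel. Qed.

Lemma sublevel_epred12 u : lev u.1 u.2 = estage (epred12 u).
Proof.
by case: u => -[|a] [|b]; rewrite ?sublevel0l ?sublevel0r //= stage_sublevel.
Qed.

Lemma sublevel_stage u : lev u.1.+1 u.2.+1 = estage (Some u).
Proof. by case: u => a b; rewrite /= stage_sublevel. Qed.

Variable q : nat.
Notation V := (persistence_module Xf q).

(** The value at [None] matches the empty stage there, so grades on the border of $\mathbb{N}^2$
    need no separate treatment. *)
Definition eclass o : 'Hom({ffun X -> F^o}, epart V o) :=
  if o is Some u then hclass (Xf u) q else 0.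

Arguments eclass : simpl never.

Lemma eclass_surj o x : exists2 z, z \in zchains (estage o) q & x = eclass o z.
Proof.
case: o x => [u|] x; first exact: hclass_surj.
by exists 0; rewrite ?mem0v //; apply: epart_None.
Qed.

Lemma eclass_eq0 o z : z \in zchains (estage o) q ->
  (eclass o z == 0) = (z \in bchains (estage o) q).
Proof.
case: o => [u|] zZ; first exact: hclass_eq0.
have /zchainsP[/chains_set0 -> _] := zZ.
by rewrite linear0 eqxx mem0v.
Qed.

Lemma emul_eclass o p z : ole o p -> z \in zchains (estage o) q ->
  emul V o p (eclass o z) = eclass p z.
Proof.
case: o p => [u|] [v|] // uv zZ.
- by rewrite /emul /= (persist_mapE _ _ uv) hclass_incl.
- by have /zchainsP[/chains_set0 -> _] := zZ; rewrite !linear0.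
- exact: epart_None.
Qed.

Lemma estage_sub o p : ole o p -> estage o \subset estage p.
Proof.
by case: o p => [u|] [v|] //= uv; rewrite ?sub0set // stage_sub.
Qed.

Lemma zchains_estage o p z : ole o p ->
  z \in zchains (estage o) q -> z \in zchains (estage p) q.
Proof.
move=> op /zchainsP[zA dz]; apply/zchainsP; split=> //.
by apply: subvP zA; apply/chains_sub/estage_sub.
Qed.

Lemma koszul0_persistence u :
  koszul0 V u <-> koszul_chain0 (fun s => (h s).1) (fun s => (h s).2) q u.1 u.2.
Proof.
have [le1 le2] := (epred1_le u, epred2_le u).
rewrite /koszul_chain0 sublevel_stage sublevel_epred1 sublevel_epred2.
split=> [K z zZ|K m].
  have [m1 [m2 E]] := K (eclass (Some u) z).
  have [z1 z1Z m1E] := eclass_surj m1; have [z2 z2Z m2E] := eclass_surj m2.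
  exists z1, z2; split=> //; rewrite -(eclass_eq0 (o := Some u)).
    by rewrite linearB linearD /= E m1E m2E !emul_eclass // subrr.
  by rewrite memvB // memvD // (zchains_estage _ z1Z, zchains_estage _ z2Z).
have [z zZ ->] := eclass_surj m; have [z1 [z2 [z1Z z2Z zB]]] := K z zZ.
exists (eclass _ z1), (eclass _ z2); rewrite !emul_eclass // -linearD.
apply/eqP; rewrite -subr_eq0 -linearB eclass_eq0 //.
by rewrite memvB // memvD // (zchains_estage _ z1Z, zchains_estage _ z2Z).
Qed.

Lemma koszul1_persistence u :
  koszul1 V u <-> koszul_chain1 (fun s => (h s).1) (fun s => (h s).2) q u.1 u.2.
Proof.
have [le1 le2] := (epred1_le u, epred2_le u).
have [le01 le02] := (epred12_le1 u, epred12_le2 u).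
rewrite /koszul_chain1 sublevel_stage sublevel_epred1 sublevel_epred2.
rewrite sublevel_epred12; split=> [K z1 z2 z1Z z2Z zB|K m1 m2].
  have [|m0 E1 E2] := K (eclass _ z1) (eclass _ z2).
    rewrite !emul_eclass // -linearD; apply/eqP.
    rewrite eclass_eq0 // memvD //.
      exact: zchains_estage z1Z.
    exact: zchains_estage z2Z.
  have [z0 z0Z m0E] := eclass_surj m0; exists z0; split=> //.
    rewrite -eclass_eq0 ?memvB // ?(zchains_estage _ z0Z) //.
    by rewrite linearB /= E1 m0E emul_eclass // subrr.
  rewrite -eclass_eq0 ?memvD // ?(zchains_estage _ z0Z) //.
  by rewrite linearD /= E2 m0E emul_eclass // addNr.
have [z1 z1Z ->] := eclass_surj m1; have [z2 z2Z ->] := eclass_surj m2.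
have zZ : z1 + z2 \in zchains (estage (Some u)) q.
  by rewrite memvD // (zchains_estage _ z1Z, zchains_estage _ z2Z).
rewrite !emul_eclass // -linearD => /eqP; rewrite eclass_eq0 // => zB.
have [z0 [z0Z B1 B2]] := K _ _ z1Z z2Z zB.
exists (eclass _ z0); rewrite emul_eclass //; apply/eqP.
  by rewrite -subr_eq0 -linearB eclass_eq0 // memvB // (zchains_estage _ z0Z).
rewrite -addr_eq0 -linearD eclass_eq0 //.
by rewrite memvD // (zchains_estage _ z0Z).
Qed.

Lemma koszul2_persistence u :
  koszul2 V u <-> koszul_chain2 (fun s => (h s).1) (fun s => (h s).2) q u.1 u.2.
Proof.
have [le01 le02] := (epred12_le1 u, epred12_le2 u).
rewrite /koszul_chain2 sublevel_epred1 sublevel_epred2 sublevel_epred12.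
split=> [K z zZ B1 B2|K m].
  rewrite -eclass_eq0 //; apply/eqP/K; rewrite emul_eclass //; apply/eqP;
    by rewrite eclass_eq0 // (zchains_estage _ zZ).
have [z zZ ->] := eclass_surj m; rewrite !emul_eclass // => /eqP + /eqP.
rewrite !eclass_eq0 ?(zchains_estage _ zZ) // => B1 B2.
by apply/eqP; rewrite eclass_eq0 // K.
Qed.

Lemma critical_grade_sublevel u : ~ critical_grades Xf q u <->
  noncritical (fun s => (h s).1) (fun s => (h s).2) q u.1 u.2.
Proof.
have E : subU (stage_pred1 Xf u) (stage_pred2 Xf u) =
    lower (fun s => (h s).1) (fun s => (h s).2) u.1 u.2 :> {set X}.
  rewrite /lower sublevel_epred1 sublevel_epred2; congr (_ :|: _).
    by case: u => -[|a] b.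
  by case: u => a [|b].
rewrite /noncritical sublevel_stage -E.
rewrite -(rel_homology_eq0P (stage_pred_sub Xf u)) /critical_grades.
by split=> [/negP|/eqP ->]; rewrite ?negbK ?eqxx.
Qed.

End KoszulPersistence.

(** * Exchanging the two coordinates, to deduce rows from columns *)

Section Transpose.
Variables (F : fieldType) (X : cell_complex F) (f g : X -> nat).

Lemma sublevelC a b : sublevel f g a b = sublevel g f b a.
Proof. by apply/setP => s; rewrite !inE andbC. Qed.

Lemma noncriticalC q a b : noncritical f g q a b -> noncritical g f q b a.
Proof.
by rewrite /noncritical /lower -!sublevelC => nc; rewrite setUC; apply: nc.
Qed.

Lemma koszul_chain0C q a b : koszul_chain0 f g q a b -> koszul_chain0 g f q b a.
Proof.
rewrite /koszul_chain0 -!sublevelC => K z /K.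
by move=> [z1 [z2 [z1Z z2Z zB]]]; exists z2, z1; rewrite [z2 + z1]addrC.
Qed.

Lemma koszul_chain2C q a b : koszul_chain2 f g q a b -> koszul_chain2 g f q b a.
Proof.
rewrite /koszul_chain2 -!sublevelC => K z zZ z1 z2; exact: K.
Qed.

End Transpose.

(** Points $(a,j)$ and $(i,b)$ of $C$ with $j\le b$ and $i\le a$ have join $(a,b)$. *)
Lemma lub_closure_cases (C : pred grade) a b :
  [\/ lub_closure (fun u => C u) (a, b),
      forall j, (j <= b)%N -> ~~ C (a, j) |
      forall i, (i <= a)%N -> ~~ C (i, b)].
Proof.
have [/existsP[j Cj]|/existsPn nC] := boolP [exists j : 'I_b.+1, C (a, val j)];
  last by constructor 2 => j jb; apply: (nC (Ordinal (jb : (j < b.+1)%N))).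
have [/existsP[i Ci]|/existsPn nC] := boolP [exists i : 'I_a.+1, C (val i, b)];
  last by constructor 3 => i ia; apply: (nC (Ordinal (ia : (i < a.+1)%N))).
constructor 1; exists [:: (a, val j); (val i, b)]; split=> //.
  by move=> v; rewrite !inE => /orP[] /eqP ->.
rewrite !big_cons big_nil joinx0.
by congr pair; apply/esym; [apply/join_l/leq_ord|apply/join_r/leq_ord].
Qed.

(** * Supports of the Betti tables and critical grades *)

Section OneCritical.
Variables (F : fieldType) (X : cell_complex F) (Xf : bifiltration X).
Variable h : X -> grade.
Hypothesis h_face : forall s t : X, face s t -> (h s <= h t)%O.
Hypothesis Xf_h : forall u, Xf u = [set s | (h s <= u)%O] :> {set X}.

(** Boolean form of [critical_grades], as [lub_closure_cases] decides by finite search. *)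
Definition is_critical q : pred grade :=
  fun u => \dim {: rel_homology (stage_pred_sub Xf u) q} != 0%N.

Lemma h1_face (s t : X) : kappa t s != 0 -> ((h s).1 <= (h t).1)%N.
Proof. by move=> kts; have /andP[] := h_face (connect1 kts : face s t). Qed.

Lemma h2_face (s t : X) : kappa t s != 0 -> ((h s).2 <= (h t).2)%N.
Proof. by move=> kts; have /andP[] := h_face (connect1 kts : face s t). Qed.

Lemma supp_betti0 q u :
  supp_betti Xf q 0 u -> lub_closure (critical_grades Xf q) u.
Proof.
have ncE w := critical_grade_sublevel Xf_h q w.
case: u => a b tor; have [//|C|C] := lub_closure_cases (is_critical q) a b;
  case/negP: tor; apply/tor0_koszul/(koszul0_persistence Xf_h).
  by apply: (column_koszul0 h1_face h2_face) => j /C/negP/ncE.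
apply/koszul_chain0C/(column_koszul0 h2_face h1_face) => j /C/negP/ncE.
exact: noncriticalC.
Qed.

Lemma supp_betti1 q u : supp_betti Xf q 1 u -> critical_grades Xf q.+1 u.
Proof.
move=> tor; apply: contraNT tor => /negP /(critical_grade_sublevel Xf_h).
move=> /(koszul1_noncritical h1_face h2_face)/(koszul1_persistence Xf_h).
by move/tor1_koszul.
Qed.

Lemma supp_betti2 q u :
  supp_betti Xf q 2 u -> lub_closure (critical_grades Xf q.+1) u.
Proof.
have ncE w := critical_grade_sublevel Xf_h q.+1 w.
case: u => a b tor.
have [//|C|C] := lub_closure_cases (is_critical q.+1) a b;
  case/negP: tor; apply/tor2_koszul/(koszul2_persistence Xf_h).
  by apply: (column_koszul2 h1_face h2_face) => j /C/negP/ncE.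
apply/koszul_chain2C/(column_koszul2 h2_face h1_face) => j /C/negP/ncE.
exact: noncriticalC.
Qed.

Lemma critical_supp_betti q u : critical_grades Xf q u ->
  exists p, exists2 i, (i <= 2)%N & supp_betti Xf p i u.
Proof.
move=> Cu.
have [/tor0_koszul K0|] := boolP (betti Xf q 0 u == 0%N); last by exists q, 0%N.
(* For $q\le 1$ a truncated predecessor may be 0 in place of a negative degree. The corresponding
   condition of [noncritical_koszul] is then void, and a nonzero Betti number found there is still a
   valid witness. *)
have [/tor1_koszul K1|] := boolP (betti Xf q.-1 1 u == 0%N).
  have [/tor2_koszul K2|] := boolP (betti Xf q.-2 2 u == 0%N).
    suff /(critical_grade_sublevel Xf_h) : noncritical (fun s => (h s).1)
      (fun s => (h s).2) q u.1 u.2 by move/(_ Cu).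
    apply: (noncritical_koszul h1_face h2_face).
    - exact/koszul0_persistence.
    - by move=> p qE; apply/koszul1_persistence; rewrite // qE in K1.
    - by move=> p qE; apply/koszul2_persistence; rewrite // qE in K2.
  by exists q.-2, 2%N.
by exists q.-1, 1%N.
Qed.

End OneCritical.

Lemma sub_lub_closure (G : grade -> Prop) u : G u -> lub_closure G u.
Proof.
move=> Gu; exists [:: u]; split=> // [v|]; rewrite ?big_seq1 //.
by rewrite inE => /eqP->.
Qed.

From mathcomp Require Import classical_sets.

Local Open Scope classical_set_scope.

Theorem corollary6p6 (F : fieldType) (X : cell_complex F)
    (Xf : bifiltration X) (hXf : one_critical Xf) :
  (forall q : nat,
     supp_betti Xf q 0 `|` supp_betti Xf q 1 `|` supp_betti Xf q 2 `<=`
       lub_closure (critical_grades Xf q) `|`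
       lub_closure (critical_grades Xf q.+1)) /\
  (\bigcup_(q : nat) critical_grades Xf q `<=`
     \bigcup_(q : nat) \bigcup_(i in [set i : nat | (i <= 2)%N])
       supp_betti Xf q i) /\
  (\bigcup_(q : nat) \bigcup_(i in [set i : nat | (i <= 2)%N])
       supp_betti Xf q i `<=`
     \bigcup_(q : nat) lub_closure (critical_grades Xf q)).
Proof.
have [h [h_face Xf_h]] := hXf; split; [|split].
- move=> q u [[]|]; first by left; apply: (supp_betti0 h_face Xf_h).
    by right; apply/sub_lub_closure/(supp_betti1 h_face Xf_h).
  by right; apply: (supp_betti2 h_face Xf_h).
- move=> u [q _ /(critical_supp_betti h_face Xf_h)[p [i i2 pi]]].
  by exists p => //; exists i.
- move=> u [q _ [[|[|[|//]]] _]].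
  + by exists q => //; apply: (supp_betti0 h_face Xf_h).
  + by exists q.+1 => //; apply/sub_lub_closure/(supp_betti1 h_face Xf_h).
  + by exists q.+1 => //; apply: (supp_betti2 h_face Xf_h).
Qed.
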